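(* There exists an $O(n^4)$-time algorithm that computes the strong chromatic index $s\chi'(G)$ of a chordal bipartite graph $G$ on $n$ vertices.
   Context: A bipartite graph is chordal bipartite if it has no induced cycle of length more than four. A strong edge coloring of $G$ is a proper edge coloring such that no edge is adjacent to two edges of the same color; the strong chromatic index $s\chi'(G)$ is the minimum number of colors in such a coloring. *)

(* Defs.v *)
From mathcomp Require Import all_boot.
Set Implicit Arguments. Unset Strict Implicit. Unset Printing Implicit Defensive.

Definition simple_graph (T : finType) (e : rel T) : Prop :=
  (forall x y, e x y = e y x) /\ (forall x, ~~ e x x).

Definition bipartite (T : finType) (e : rel T) : Prop :=
  exists side : T -> bool, forall x y, e x y -> side x != side y.

Definition induced_cycle (T : finType) (e : rel T) (s : seq T) : Prop :=
  uniq s /\ 3 <= size s /\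
  forall i j, i < size s -> j < size s -> forall x0 : T,
    e (nth x0 s i) (nth x0 s j) =
      ((j == (i.+1) %% size s) || (i == (j.+1) %% size s)).

Definition chordal_bipartite (T : finType) (e : rel T) : Prop :=
  bipartite e /\ forall s : seq T, induced_cycle e s -> size s <= 4.

(* Strong edge colouring with colours {0,...,k-1}: c assigns a colour to each
   edge {x,y} (c x y = c y x); two distinct edges that share a vertex, or are
   joined by an edge, get different colours (i.e. proper, and no edge is
   adjacent to two edges of the same colour). *)
Definition strong_edge_coloring (T : finType) (e : rel T) (k : nat)
    (c : T -> T -> nat) : Prop :=
  (forall x y, e x y -> c x y = c y x /\ c x y < k) /\
  (forall x y u v, e x y -> e u v -> [set x; y] != [set u; v] ->
     [|| x == u, x == v, y == u, y == v, e x u, e x v, e y u | e y v] ->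
     c x y != c u v).

Definition strong_k_colorable (T : finType) (e : rel T) (k : nat) : Prop :=
  exists c, strong_edge_coloring e k c.

Definition is_strong_chromatic_index (T : finType) (e : rel T) (m : nat) : Prop :=
  strong_k_colorable e m /\ forall k, strong_k_colorable e k -> m <= k.

Inductive instr : Type :=
  | IConst of nat & nat
  | IAdd of nat & nat & nat
  | ISub of nat & nat & nat
  | ILoad of nat & nat
  | IStore of nat & nat
  | IJz of nat & nat
  | IJmp of nat
  | IHalt.

Record ram_state := RamState { pc : nat; regs : nat -> nat }.

Definition upd (m : nat -> nat) (r v : nat) : nat -> nat :=
  fun i => if i == r then v else m i.

(* one step; a halted machine (pc on IHalt or outside the program) stays put *)
Definition ram_step (P : seq instr) (s : ram_state) : ram_state :=
  let m := regs s in let p := pc s in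
  match nth IHalt P p with
  | IConst r k => RamState p.+1 (upd m r k)
  | IAdd r a b => RamState p.+1 (upd m r (m a + m b))
  | ISub r a b => RamState p.+1 (upd m r (m a - m b))
  | ILoad r a => RamState p.+1 (upd m r (m (m a)))
  | IStore a r => RamState p.+1 (upd m (m a) (m r))
  | IJz r l => RamState (if m r == 0 then l else p.+1) m
  | IJmp l => RamState l m
  | IHalt => s
  end.

Definition ram_run (P : seq instr) (t : nat) (s : ram_state) : ram_state :=
  iter t (ram_step P) s.

Definition ram_halted (P : seq instr) (s : ram_state) : bool :=
  if nth IHalt P (pc s) is IHalt then true else false.

Definition adjn (n : nat) (e : rel 'I_n) (i j : nat) : bool :=
  [exists x : 'I_n, exists y : 'I_n,
     [&& nat_of_ord x == i, nat_of_ord y == j & e x y]].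

(* Input encoding of a graph on 'I_n: R[0] = n, R[1 + i*n + j] = [ij is an edge]
   (adjacency matrix), all other registers 0; execution starts at pc 0. *)
Definition graph_input (n : nat) (e : rel 'I_n) : ram_state :=
  RamState 0 (fun k => if k == 0 then n
                       else if k.-1 < n * n then
                              nat_of_bool (adjn e (k.-1 %/ n) (k.-1 %% n))
                            else 0).

(* Main.v *)
Require Import Defs.
From mathcomp Require Import all_boot all_fingroup zify.
Set Implicit Arguments. Unset Strict Implicit. Unset Printing Implicit Defensive.

(** View the adjacency matrix [M] of the graph as that of its bipartite double
    cover: edges are pairs (row, column), and two of them conflict when one of
    the two corners of the rectangle they span is an edge.

    A row is simple when the columns through it are nested.  A doubly lexical
    ordering of the rows and columns (one maximizing the sum of 2^(i+j) over all
    ones of the matrix) contains no Gamma, since a Gamma grows into a long induced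
    cycle; hence every nonempty set of rows of a chordal bipartite graph has a
    simple row.  From this it follows that every set of at least two edges contains
    two edges u, v with N(u) - v included in N(v).  A graph all of whose induced
    subgraphs have such a pair is perfect, so the strong chromatic index is the
    maximum number [omega] of pairwise conflicting edges.

    If i is a simple row of a set Z of rows, then a largest clique in Z either
    avoids row i or, c being its smallest column in row i, consists of all edges
    in the columns d >= c of row i together with a largest clique in the rows of
    Z - i meeting c.  Adding the rows in the reverse of a simple elimination
    order, this computes [omega] for the rows of every column; a sum over d for
    every triple (i, j, c) costs O(n^4), like the search for the simple rows. *)

(** * Simple rows of chordal bipartite graphs *)

(** The input comes without a bipartition and none is computed: in the double cover every vertex is
    both a row and a column. An edge and its reverse never conflict, since that would need a loop,
    so a clique cannot count an edge twice. Columns through a simple row form a chain, so their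
    sizes alone decide inclusion. The recurrence therefore needs no sets: it runs on one size and
    one clique number per column. On the machine the obstacle is space. The matrix fills the
    registers without a gap, while instructions name fixed registers, so the input is first spread
    out with stride 16, which leaves whole residue classes free for variables. The exponent 4 is
    then read off from the syntax: all loops run [n] times, so the compiled code takes a constant
    times [n.+1 ^ depth] steps, and the loops nest four deep. *)

Lemma sum_pow2_lt (T : finType) (p : T -> nat) (k : nat) :
  injective p -> \sum_(z | p z < k) 2 ^ p z < 2 ^ k.
Proof.
move=> pI; elim: k => [|k IHk]; first by rewrite big_pred0.
rewrite (bigID (fun z => p z == k)) /= addnC.
have -> : \sum_(z | (p z < k.+1) && (p z != k)) 2 ^ p z = \sum_(z | p z < k) 2 ^ p z.
  by apply: eq_bigl => z; lia.
suff : \sum_(z | (p z < k.+1) && (p z == k)) 2 ^ p z <= 2 ^ k.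
  by rewrite expnS; lia.
case: (pickP (fun z => p z == k)) => [z /eqP zk|no]; last first.
  by rewrite big_pred0 // => z; rewrite no andbF.
rewrite (big_pred1 z) ?zk // => w /=; apply/andP/eqP => [[_ /eqP wk]|->].
  by apply: pI; rewrite wk.
by rewrite zk eqxx ltnSn.
Qed.

(** The sums are binary numbers with digit positions [p], so the highest position at which [P] and
    [Q] differ decides which is larger. That position is the witness. *)
Lemma lex_witness (T : finType) (p : T -> nat) (P Q : pred T) (y : T) :
  injective p -> \sum_(z | P z) 2 ^ p z <= \sum_(z | Q z) 2 ^ p z ->
  P y -> ~~ Q y ->
  exists y', [/\ ~~ P y', Q y', p y < p y' &
                 forall z, p y' < p z -> P z = Q z].
Proof.
move=> pI le Py Qy.
have Dy : P y != Q y by rewrite Py (negbTE Qy).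
case: (@arg_maxnP _ y (fun z => P z != Q z) p Dy) => w Dw wmax0.
have wmax z : P z != Q z -> p z <= p w by exact: wmax0.
have agree z : p w < p z -> P z = Q z.
  by move=> lt; apply/eqP; apply: contraTT lt => /wmax; lia.
have [Pw|Pw] := boolP (P w); last first.
  exists w; split=> //; first by move: Dw Pw; case: (P w) (Q w) => -[].
  rewrite ltn_neqAle wmax // andbT; apply: contraNneq Pw => /pI <-; exact: Py.
have Qw : ~~ Q w by move: Dw Pw; case: (P w) (Q w) => -[].
suff : \sum_(z | Q z) 2 ^ p z < \sum_(z | P z) 2 ^ p z by rewrite ltnNge le.
rewrite [X in _ < X](bigID (fun z => p w < p z)) /=.
rewrite (bigID (fun z => p w < p z)) /=.
have -> : \sum_(z | P z && (p w < p z)) 2 ^ p z = \sum_(z | Q z && (p w < p z)) 2 ^ p z.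
  by apply: eq_bigl => z; case: (ltnP (p w) (p z)) => [/agree ->|]; rewrite ?andbF.
rewrite ltn_add2l [X in _ < X](bigD1 w) /=; last by rewrite Pw ltnn.
apply: leq_trans (leq_addr _ _).
apply: leq_ltn_trans (sum_pow2_lt (p w) pI).
rewrite [X in X <= _]big_mkcond [X in _ <= X]big_mkcond /=; apply: leq_sum => z _.
case: ifP => // /andP[Qz]; rewrite -leqNgt leq_eqVlt => /orP[/eqP/pI zw|->//].
by rewrite -zw Qz in Qw.
Qed.

(** * Doubly lexical orderings of a matrix *)

Section DoublyLexical.
Variables (T : finType) (M : rel T).

Definition pos (s : {perm T}) (x : T) : nat := enum_rank (s x).

Lemma pos_inj s : injective (pos s).
Proof. by move=> x y /val_inj/enum_rank_inj/perm_inj. Qed.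

Definition dlweight (N : rel T) (s t : {perm T}) :=
  \sum_x 2 ^ pos s x * \sum_(y | N x y) 2 ^ pos t y.

Lemma dlweight_sym N s t :
  dlweight N s t = dlweight (fun x y => N y x) t s.
Proof.
rewrite /dlweight; under eq_bigr => x _ do rewrite big_distrr /= big_mkcond /=.
rewrite exchange_big /=; apply: eq_bigr => y _.
rewrite big_distrr /= [RHS]big_mkcond /=; apply: eq_bigr => x _.
by rewrite mulnC.
Qed.

(* Swapping two rows in the wrong order increases the weight. *)
Lemma dlweight_max_rows (N : rel T) s t :
  (forall s', dlweight N s' t <= dlweight N s t) ->
  forall x x', pos s x < pos s x' ->
  \sum_(y | N x y) 2 ^ pos t y <= \sum_(y | N x' y) 2 ^ pos t y.
Proof.
move=> smax x x' lt; rewrite leqNgt; apply/negP => gt.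
have xx' : x' != x by apply: contraTneq lt => ->; rewrite ltnn.
have := smax (tperm x x' * s)%g; rewrite leqNgt => /negP; apply.
have E (f : T -> nat) :
    \sum_z f z = f x + f x' + \sum_(z | (z != x) && (z != x')) f z.
  by rewrite (bigD1 x) //= (bigD1 (P := fun z => z != x) x') //= addnA.
rewrite /dlweight !E.
have -> : \sum_(i | (i != x) && (i != x')) 2 ^ pos (tperm x x' * s) i * \sum_(y | N i y) 2 ^ pos t y
  = \sum_(i | (i != x) && (i != x')) 2 ^ pos s i * \sum_(y | N i y) 2 ^ pos t y.
  apply: eq_bigr => i /andP[ix ix']; congr (2 ^ _ * _).
  by rewrite /pos permM tpermD // eq_sym.
rewrite ltn_add2r.
have -> : pos (tperm x x' * s) x = pos s x' by rewrite /pos permM tpermL.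
have -> : pos (tperm x x' * s) x' = pos s x by rewrite /pos permM tpermR.
have : 2 ^ pos s x < 2 ^ pos s x' by rewrite ltn_exp2l.
move: gt; move: (2 ^ pos s x) (2 ^ pos s x') (\sum_(y | N x y) _) (\sum_(y | N x' y) _) => a b c d.
nia.
Qed.

(** A pair of orders of maximal weight is maximal in each order separately, so swapping two rows or,
    after transposition, two columns cannot help. The agreement beyond the witness is recorded
    because the growth of induced paths relies on it. *)
Lemma doubly_lexical : exists s t : T -> nat,
  [/\ injective s, injective t,
  (forall x x' y, s x < s x' -> M x y -> ~~ M x' y -> exists y',
     [/\ ~~ M x y', M x' y', t y < t y' & forall w, t y' < t w -> M x w = M x' w]) &
  (forall y y' x, t y < t y' -> M x y -> ~~ M x y' -> exists x',
     [/\ ~~ M x' y, M x' y', s x < s x' & forall w, s x' < s w -> M w y = M w y'])].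
Proof.
pose P0 := fun _ : {perm T} * {perm T} => true.
have tt0 : P0 (1%g, 1%g) by [].
case: (@arg_maxnP _ _ P0 (fun st => dlweight M st.1 st.2) tt0) => -[s t] _ /= stmax.
exists (pos s), (pos t); split; try exact: pos_inj.
  move=> x x' y lt Mxy Mx'y.
  have smax s' : dlweight M s' t <= dlweight M s t by exact: (stmax (s', t)).
  exact: (lex_witness (@pos_inj t) (dlweight_max_rows smax lt)).
move=> y y' x lt Mxy Mxy'.
have tmax t' : dlweight (fun x y => M y x) t' s <= dlweight (fun x y => M y x) t s.
  have : dlweight M s t' <= dlweight M s t by exact: (stmax (s, t')).
  by rewrite (dlweight_sym M s t') (dlweight_sym M s t).
exact: (lex_witness (@pos_inj s) (dlweight_max_rows tmax lt)).
Qed.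
End DoublyLexical.

(** * Induced paths and their extension at both ends *)

Section InducedPaths.
Variables (T : finType) (e : rel T).
Hypothesis eC : forall x y, e x y = e y x.

Definition induced_path (p : seq T) :=
  uniq p /\ forall x0 i j, i < size p -> j < size p ->
    e (nth x0 p i) (nth x0 p j) = (j == i.+1) || (i == j.+1).

Lemma induced_path_rev p : induced_path p -> induced_path (rev p).
Proof.
case=> up Hp; split; first by rewrite rev_uniq.
move=> x0 i j; rewrite size_rev => lti ltj.
rewrite !nth_rev // Hp; lia.
Qed.

(** On an induced path with at least three vertices every vertex has a neighbour other than the
    head: its successor or, at the far end, its predecessor. *)
Lemma nbr_head_notin p x0 v : induced_path p -> 3 <= size p ->
  (forall x, x \in p -> e v x = (x == nth x0 p 0)) -> v \notin p.
Proof.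
move=> [up Hp] sp Hv; apply/negP => vp.
have [i lti vE] : exists2 i, i < size p & v = nth x0 p i.
  by exists (index v p); rewrite ?index_mem ?nth_index.
case: (ltnP i.+1 (size p)) => lt.
  have := Hv _ (mem_nth x0 lt); have lt0 : 0 < size p by lia.
  by rewrite vE Hp // eqxx nth_uniq.
have lt1 : i.-1 < size p by lia.
have := Hv _ (mem_nth x0 lt1).
have lt0 : 0 < size p by lia.
by rewrite vE Hp // nth_uniq //; lia.
Qed.

(** Only the adjacency of [a] and [b] is left open: with it the sequence closes into an induced
    cycle, without it the induced path has become longer. One formula serves both cases. *)
Lemma induced_path_extend p x0 a b :
  induced_path p -> 3 <= size p -> ~~ e a a -> ~~ e b b ->
  (forall x, x \in p -> e a x = (x == nth x0 p 0)) ->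
  (forall x, x \in p -> e b x = (x == nth x0 p (size p).-1)) ->
  uniq (a :: rcons p b) /\ forall y0 i j, i < (size p).+2 -> j < (size p).+2 ->
   e (nth y0 (a :: rcons p b) i) (nth y0 (a :: rcons p b) j) =
   [|| j == i.+1, i == j.+1 | e a b && (i + j == (size p).+1) && ((i == 0) || (j == 0))].
Proof.
move=> ip sp ea eb Ha Hb; have [up Hp] := ip.
have ap : a \notin p by exact: nbr_head_notin ip sp Ha.
have bp : b \notin p.
  rewrite -mem_rev; apply: (@nbr_head_notin _ x0); rewrite ?size_rev //.
    exact: induced_path_rev.
  move=> x; rewrite mem_rev => /Hb ->; rewrite nth_rev ?subn1 //; lia.
have lt0 : 0 < size p by lia.
have ltl : (size p).-1 < size p by lia.
have h0 : nth x0 p 0 \in p by rewrite mem_nth.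
have ab : a != b.
  apply/eqP => ab; have := Ha _ h0; rewrite eqxx ab Hb // nth_uniq //; lia.
split; first by rewrite /= mem_rcons inE negb_or ab ap rcons_uniq bp.
have Ha' y0 i : i < size p -> e a (nth y0 p i) = (i == 0).
  by move=> lt; rewrite Ha ?mem_nth // (set_nth_default x0) // nth_uniq.
have Hb' y0 i : i < size p -> e b (nth y0 p i) = (i == (size p).-1).
  by move=> lt; rewrite Hb ?mem_nth // (set_nth_default x0) // nth_uniq //; lia.
move=> y0 i j lti ltj.
have E k : nth y0 (a :: rcons p b) k =
    if k == 0 then a else if k.-1 < size p then nth y0 p k.-1 else
    if k.-1 == size p then b else y0.
  by case: k => [|k] //=; rewrite nth_rcons.
rewrite !E.
case: (eqVneq i 0) => [i0|i0]; case: (eqVneq j 0) => [j0|j0].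
- by rewrite (negbTE ea); lia.
- case: ltnP => jp; first by rewrite Ha' //; lia.
  have -> : j.-1 == size p by lia.
  by case: (e a b); lia.
- case: ltnP => jp; first by rewrite eC Ha' //; lia.
  have -> : i.-1 == size p by lia.
  by rewrite eC; case: (e a b); lia.
case: ltnP => ip'; case: ltnP => jp.
- by rewrite Hp //; lia.
- have -> : j.-1 == size p by lia.
  by rewrite eC Hb' //; lia.
- have -> : i.-1 == size p by lia.
  by rewrite Hb' //; lia.
have -> : i.-1 == size p by lia.
have -> : j.-1 == size p by lia.
by rewrite (negbTE eb); lia.
Qed.
End InducedPaths.

Definition nested_on (X Y : finType) (M : X -> Y -> bool) (S : {set X}) (c d : Y) :=
  [forall z in S, M z c ==> M z d].

Lemma nested_onP (X Y : finType) (M : X -> Y -> bool) (S : {set X}) c d :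
  reflect (forall z, z \in S -> M z c -> M z d) (nested_on M S c d).
Proof. by apply: (iffP forall_inP) => H z zS; apply/implyP; apply: H. Qed.

Definition simple_row (X Y : finType) (M : X -> Y -> bool) (S : {set X}) (x : X) :=
  [forall c, forall d, M x c ==> M x d ==> (nested_on M S c d || nested_on M S d c)].

Lemma simple_rowP (X Y : finType) (M : X -> Y -> bool) (S : {set X}) x :
  reflect (forall c d, M x c -> M x d -> nested_on M S c d || nested_on M S d c)
          (simple_row M S x).
Proof.
apply: (iffP forallP) => [H c d xc xd|H c].
  by move: (H c) => /forallP/(_ d); rewrite xc xd.
by apply/forallP => d; apply/implyP => xc; apply/implyP => xd; apply: H.
Qed.

(** * Absence of Gammas and simple rows *)

Section SimpleRow.
Variables (T : finType) (e : rel T).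
Hypotheses (eS : simple_graph e) (eB : chordal_bipartite e).

Let eC x y : e x y = e y x. Proof. by case: eS. Qed.
Let eI x : ~~ e x x. Proof. by case: eS. Qed.

(** A Gamma is an induced path [d], [x], [c], [z]. The two lexical witnesses provide a new row and a
    new column, each seeing just one end of the path. If they are adjacent, a long induced cycle
    appears; if not, the path grows and its end row moves up in the order [s], which is bounded. *)
Lemma Gamma_free (S : {set T}) (s t : T -> nat) :
  let M := fun x y => (x \in S) && e x y in
  injective s -> injective t ->
  (forall x x' y, s x < s x' -> M x y -> ~~ M x' y -> exists y',
     [/\ ~~ M x y', M x' y', t y < t y' & forall w, t y' < t w -> M x w = M x' w]) ->
  (forall y y' x, t y < t y' -> M x y -> ~~ M x y' -> exists x',
     [/\ ~~ M x' y, M x' y', s x < s x' & forall w, s x' < s w -> M w y = M w y']) ->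
  forall x z c d, s x < s z -> t c < t d -> M x c -> M x d -> M z c -> M z d.
Proof.
move=> M sI tI Hr Hc.
have [[side sideP] noC] := eB.
(* Invariant: [p] runs from the column [j] to the row [i], and [j'], [i'] are the ends before the
   last extension. Rows above [i] do not distinguish the columns of [p] other than [j]; columns
   above [j] do not distinguish the rows of [p] other than [i]. Rows are the vertices on side [b],
   and [k] bounds how far [i] can still move up. *)
have key : forall k b p i' i j' j, \max_v s v - s i < k ->
  induced_path e p -> 3 < size p -> nth i p 0 = j -> nth i p (size p).-1 = i ->
  side i = b -> side j = ~~ b -> (forall x, x \in p -> side x = b -> x \in S) ->
  t j' < t j -> s i' < s i -> M i j' -> ~~ M i j -> M i' j ->
  (forall z, s i < s z -> forall y, y \in p -> side y = ~~ b -> y != j -> M z y = M z j') ->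
  (forall w, t j < t w -> forall x, x \in p -> side x = b -> x != i -> M x w = M i' w) ->
  False.
  elim=> // k IHk b p i' i j' j ltk ip sp hd lst si sj pS ltt lts Mij' Mij Mi'j Az Aw.
  have [a [Maj' Maj ltia Ha]] := Hc _ _ _ ltt Mij' Mij.
  have [c [Mi'c Mic ltjc Hc']] := Hr _ _ _ lts Mi'j Mij.
  have aS : a \in S by case/andP: Maj.
  have iS : i \in S by case/andP: Mij'.
  have lt0 : 0 < size p by exact: leq_trans sp.
  have ltl : (size p).-1 < size p by rewrite prednK.
  have jp : j \in p by rewrite -hd mem_nth.
  have iip : i \in p by rewrite -{1}lst mem_nth.
  have sa : side a = b.
    by case/andP: Maj => _ /sideP; rewrite sj; case: (side a) (b) => -[].
  have sc : side c = ~~ b.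
    by case/andP: Mic => _ /sideP; rewrite si; case: (side c) (b) => -[].
  have sideN x y : side x = side y -> e x y = false.
    by move=> E; apply/negP => /sideP; rewrite E eqxx.
  (* By the invariant, [a] has on all columns of [p] other than [j] the entry it has at [j'], which
     is 0; the rows of [p] are on its own side. The argument for [c] is symmetric. *)
  have Ea x : x \in p -> e a x = (x == j).
    move=> xp; case: (eqVneq (side x) b) => sx.
      rewrite sideN ?sa ?sx //; apply/esym/negP => /eqP xj.
      by move: sx; rewrite xj sj; case: (b).
    have {}sx : side x = ~~ b by case: (side x) (b) sx => -[].
    case: (eqVneq x j) => [->|xj]; first by case/andP: Maj.
    have := Az a ltia x xp sx xj; rewrite (negbTE Maj') /M aS /=; exact.
  have Ec x : x \in p -> e c x = (x == i).
    move=> xp; case: (eqVneq (side x) b) => sx; last first.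
      have {}sx : side x = ~~ b by case: (side x) (b) sx => -[].
      rewrite sideN ?sc ?sx //; apply/esym/negP => /eqP xj.
      by move: sx; rewrite xj si; case: (b).
    case: (eqVneq x i) => [->|xi]; first by rewrite eC; case/andP: Mic.
    have := Aw c ltjc x xp sx xi; rewrite (negbTE Mi'c) /M (pS x) //= eC; exact.
  have rip := induced_path_rev ip.
  have r0 : nth i (rev p) 0 = i by rewrite nth_rev ?subn1.
  have rl : nth i (rev p) (size (rev p)).-1 = j.
    by rewrite size_rev nth_rev // prednK ?subnn.
  have := @induced_path_extend T e eC (rev p) i c a rip.
  rewrite rl r0 size_rev => /(_ (ltnW sp) (eI _) (eI _)).
  case=> [x|x|uq Hq]; rewrite ?mem_rev; [exact: Ec|exact: Ea|].
  (* If [c] and [a] are adjacent, the induced cycle has length [size p + 2], which is at least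
     six. *)
  have [eca|eca] := boolP (e c a).
    suff : induced_cycle e (c :: rcons (rev p) a).
      by move/noC; rewrite /= size_rcons size_rev; clear -sp; lia.
    split=> //; rewrite /= size_rcons size_rev; split=> //.
    move=> u v ltu ltv x0; rewrite Hq // eca /=.
    have M1 w : w < (size p).+2 -> w.+1 %% (size p).+2 =
        if w == (size p).+1 then 0 else w.+1.
      move=> lw; case: eqP => [->|ne]; first by rewrite modnn.
      by rewrite modn_small //; clear -lw ne; lia.
    rewrite !M1 //; clear -ltu ltv sp.
    by case: (eqVneq u (size p).+1) => ?; case: (eqVneq v (size p).+1) => ?; lia.
  (* The new ends are [c] and [a]. Agreement above them combines the old invariant with the
     agreement supplied by the two witnesses. *)
  apply: (IHk b (c :: rcons (rev p) a) i a j c) => //.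
  - have sle : s a <= \max_v s v by exact: leq_bigmax.
    by clear -sle ltk ltia; lia.
  - split=> // y0 u v; rewrite /= size_rcons size_rev => ltu ltv.
    by rewrite Hq // (negbTE eca) /= orbF.
  - by rewrite /= size_rcons size_rev; clear -sp; lia.
  - rewrite /= size_rcons size_rev /= nth_rcons size_rev ltnn eqxx //.
  - move=> x; rewrite inE mem_rcons inE mem_rev => /or3P[/eqP->|/eqP-> //|xp] sx.
      by move: sx; rewrite sc; case: (b).
    exact: pS.
  - by rewrite /M aS /= eC.
  - move=> z ltz y; rewrite inE mem_rcons inE mem_rev => /or3P[/eqP->|/eqP->|yp] sy.
    + by rewrite eqxx.
    + by move: sy; rewrite sa; case: (b).
    move=> _; have [->//|yj] := eqVneq y j.
    by rewrite (Az z _ y) //; [exact: Ha | exact: ltn_trans ltz].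
  - move=> w ltw x; rewrite inE mem_rcons inE mem_rev => /or3P[/eqP->|/eqP->|xp] sx.
    + by move: sx; rewrite sc; case: (b).
    + by rewrite eqxx.
    move=> _; have [->//|xi] := eqVneq x i.
    by rewrite (Aw w _ x) //; [exact: Hc' | exact: ltn_trans ltw].
move=> x z c d sxz tcd Mxc Mxd Mzc; apply/negPn/negP => Mzd.
have xS : x \in S by case/andP: Mxc.
have zS : z \in S by case/andP: Mzc.
have exc : e x c by case/andP: Mxc.
have exd : e x d by case/andP: Mxd.
have ezc : e z c by case/andP: Mzc.
have ezd : e z d = false by move: Mzd; rewrite /M zS => /negbTE.
have sx : side z = side x.
  by move/sideP: exc; move/sideP: ezc; case: (side z) (side x) (side c) => -[] [].
have sc : side c = ~~ side x by move/sideP: exc; case: (side x) (side c) => -[].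
have sd : side d = ~~ side x by move/sideP: exd; case: (side x) (side d) => -[].
have exz : e x z = false by apply/negP => /sideP; rewrite sx eqxx.
have ecd : e c d = false by apply/negP => /sideP; rewrite sc sd eqxx.
have nxz : x != z by apply: contraTneq sxz => ->; rewrite ltnn.
have ncd : c != d by apply: contraTneq tcd => ->; rewrite ltnn.
have nsd u v : side u = ~~ side v -> u != v.
  by move=> E; apply/eqP => uv; move: E; rewrite uv; case: (side v).
apply: (key (\max_v s v - s z).+1 (side x) [:: d; x; c; z] x z c d) => //.
- split.
    by rewrite /= !inE !negb_or nxz [d == c]eq_sym ncd ![_ == c]eq_sym
      [c == x]eq_sym !nsd // ?sx ?sd ?sc ?negbK.
  move=> x0 [|[|[|[|i]]]] [|[|[|[|j]]]] //= _ _;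
   by rewrite ?(negbTE (eI _)) // ?exc ?exd ?ezc ?ezd ?exz ?ecd // eC ?exc ?exd ?ezc ?ezd ?exz ?ecd.
- by move=> y; rewrite !inE => /or4P[]/eqP-> //; rewrite ?sc ?sd; case: (side x).
- move=> w ltw y; rewrite !inE => /or4P[]/eqP-> //; rewrite ?sx ?eqxx //; by case: (side x).
- move=> w ltw y; rewrite !inE => /or4P[]/eqP-> //; rewrite ?sc ?sd ?eqxx //; by case: (side x).
Qed.

(** The first row of [S] in the order [s] is simple: without a Gamma, its columns are nested in the
    order [t]. *)
Lemma exists_simple_row (S : {set T}) : S != set0 ->
  exists2 x, x \in S & simple_row e S x.
Proof.
case/set0Pn => x0 x0S.
have [s [t [sI tI Hr Hc]]] := doubly_lexical (fun x y => (x \in S) && e x y).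
have G := Gamma_free sI tI Hr Hc.
case: (arg_minnP s x0S) => x xS xmin; exists x => //.
have H c d : e x c -> e x d -> t c < t d -> nested_on e S c d.
  move=> xc xd lt; apply/nested_onP => z zS zc.
  have := xmin z zS; rewrite leq_eqVlt => /orP[/eqP/sI <- //|ltz].
  have /andP[//] : (z \in S) && e z d.
  by apply: (G x z c d) => //; apply/andP.
apply/simple_rowP => c d xc xd.
case: (ltngtP (t c) (t d)) => [lt|lt|/tI ->].
- by rewrite H.
- by rewrite (H d c) // orbT.
- by apply/orP; left; apply/nested_onP.
Qed.
End SimpleRow.

(** * Dominated pairs and perfection *)

Section Perfect.
Variables (V : finType) (adj : rel V).
Hypothesis adjC : symmetric adj.

Definition clique (K : {set V}) := [forall u in K, forall v in K, adj u v].

Lemma cliqueP (K : {set V}) :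
  reflect (forall u v, u \in K -> v \in K -> adj u v) (clique K).
Proof.
apply: (iffP forall_inP) => [H u v uK vK|H u uK].
  by move/forall_inP: (H u uK); apply.
by apply/forall_inP => v vK; apply: H.
Qed.

Definition proper_on (W : {set V}) (f : V -> nat) :=
  forall u v, u \in W -> v \in W -> u != v -> adj u v -> f u != f v.

Lemma clique_leq (K : {set V}) (f : V -> nat) k :
  clique K -> proper_on K f -> (forall u, u \in K -> f u < k) -> #|K| <= k.
Proof.
move=> /cliqueP cK pf; case: k => [|k] fk.
  by rewrite leqn0 cards_eq0; apply/eqP/setP => u; rewrite inE; apply/negP => /fk.
rewrite -[k.+1]card_ord -(@card_in_imset _ _ (fun u => inord (f u) : 'I_k.+1)) ?max_card //.
move=> u v uK vK /(congr1 val); rewrite /= !inordK ?fk // => E.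
by have [//|/pf/(_ (cK _ _ uK vK))] := eqVneq u v; rewrite E eqxx => /(_ uK vK).
Qed.

Definition dominated_pair (W : {set V}) u v :=
  [&& u \in W, v \in W, u != v &
      [forall w in W, (w != u) ==> (w != v) ==> adj u w ==> adj v w]].

Lemma dominated_pairP (W : {set V}) u v :
  reflect [/\ u \in W, v \in W, u != v &
             forall w, w \in W -> w != u -> w != v -> adj u w -> adj v w]
    (dominated_pair W u v).
Proof.
apply: (iffP and4P) => -[uW vW uv H]; split=> //.
  by move=> w wW wu wv uw; move/forall_inP/(_ w wW): H; rewrite wu wv uw.
by apply/forall_inP => w wW; do 3! [apply/implyP => ?]; apply: H.
Qed.

(** Let [v] dominate [u]. If they are not adjacent, [u] takes the colour of [v]. If they are, the
    colour class of [v] in a colouring of [W - u] is removed from [W]; the rest turns out to have a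
    smaller clique number, which pays for one extra colour on that class. *)
Lemma clique_coloring (W : {set V}) :
  (forall u, u \in W -> adj u u) ->
  (forall W' : {set V}, W' \subset W -> 1 < #|W'| ->
     exists u v, dominated_pair W' u v) ->
  exists K : {set V}, exists f : V -> nat,
    [/\ K \subset W, clique K, proper_on W f & forall u, u \in W -> f u < #|K|].
Proof.
have [n] := ubnP #|W|; elim: n W => // n IHn W ltn adjW dom.
have {}IHn (W' : {set V}) : W' \proper W -> exists K : {set V}, exists f : V -> nat,
    [/\ K \subset W', clique K, proper_on W' f & forall u, u \in W' -> f u < #|K|].
  move=> ltW; have sW := proper_sub ltW; apply: IHn.
  - by apply: leq_trans (proper_card ltW) _; rewrite -ltnS.
  - by move=> u /(subsetP sW); apply: adjW.
  - by move=> W2 sW2; apply: dom; apply: subset_trans sW2 sW.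
have [W1|W1] := leqP #|W| 1.
  exists W, (fun=> 0); split=> //.
  - by apply/cliqueP => u v uW vW; rewrite (card_le1_eqP W1 u v uW vW) adjW.
  - by move=> u v uW vW /eqP[]; apply: (card_le1_eqP W1).
  - by move=> u uW; apply/card_gt0P; exists u.
have [u [v /dominated_pairP[uW vW uv duv]]] := dom W (subxx _) W1.
have vWu : v \in W :\ u by rewrite !inE eq_sym uv.
have [K [f [KW cK pf fK]]] := IHn _ (properD1 uW).
have [auv|nauv] := boolP (adj u v); last first.
  exists K, (fun w => if w == u then f v else f w); split=> //.
  - exact: subset_trans KW (subsetDl _ _).
  - have H w : w \in W -> w != u -> adj u w -> f v != f w.
      move=> wW wu auw; have wv : w != v by apply: contraNneq nauv => <-.
      by apply: pf; [|rewrite !inE wu|rewrite eq_sym|apply: duv].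
    move=> w1 w2 w1W w2W; have [->|w1u] := eqVneq w1 u.
      by rewrite eq_sym => w2u; rewrite (negbTE w2u); apply: H.
    have [->|w2u] := eqVneq w2 u.
      by move=> _; rewrite adjC eq_sym; apply: H.
    by apply: pf; rewrite !inE ?w1u ?w2u.
  - move=> w wW; case: eqP => [_|/eqP wu]; first exact: fK.
    by apply: fK; rewrite !inE wu.
pose S := [set w in W :\ u | f w == f v].
have vS : v \in S by rewrite inE vWu eqxx.
have SW : S \subset W by apply/subsetP => w; rewrite !inE => /andP[/andP[]].
have uS : u \notin S by rewrite !inE eqxx.
have ltS : W :\: S \proper W.
  by apply/properP; split; [exact: subsetDl | exists v; rewrite // inE vS].
have [K2 [f2 [KW2 cK2 pf2 fK2]]] := IHn _ ltS.
(* Any clique larger than [K2] suffices: [S] is independent and gets the new colour [#|K2|]. *)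
have col (L : {set V}) : L \subset W -> clique L -> #|K2| < #|L| ->
    exists K : {set V}, exists f : V -> nat,
    [/\ K \subset W, clique K, proper_on W f & forall u, u \in W -> f u < #|K|].
  move=> LW cL ltL; exists L, (fun w => if w \in S then #|K2| else f2 w); split=> //.
    move=> w1 w2 w1W w2W w12 a12.
    case: ifP => w1S; case: ifP => w2S.
    - move: w1S w2S; rewrite inE => /andP[w1S /eqP E1]; rewrite inE => /andP[w2S /eqP E2].
      by move: (pf w1 w2 w1S w2S w12 a12); rewrite E1 E2 eqxx.
    - by rewrite gtn_eqF // fK2 // inE w2S.
    - by rewrite ltn_eqF // fK2 // inE w1S.
    - by apply: pf2; rewrite // inE ?w1S ?w2S.
  move=> w wW; case: ifP => // wS; apply: leq_ltn_trans ltL.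
  by apply: ltnW; rewrite fK2 // inE wS.
have vK2 : v \notin K2 by apply/negP => /(subsetP KW2); rewrite inE vS.
(* If [u] is in [K2], domination makes [v] adjacent to all of [K2], so adding [v] gives a larger
   clique. *)
have [uK2|uK2] := boolP (u \in K2).
  apply: (col (v |: K2)).
  - by rewrite subUset sub1set vW (subset_trans KW2) ?subsetDl.
  - have av w : w \in K2 -> adj v w.
      move=> wK; have wW : w \in W by move/(subsetP KW2): wK; rewrite inE => /andP[].
      have [->|wu] := eqVneq w u; first by rewrite adjC.
      apply: duv => //; first by apply: contraNneq vK2 => <-.
      exact: (cliqueP _ cK2).
    apply/cliqueP => w1 w2; rewrite !inE => /predU1P[->|w1K] /predU1P[->|w2K].
    + exact: adjW.
    + exact: av.
    + by rewrite adjC av.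
    + exact: (cliqueP _ cK2).
  - by rewrite cardsU1 vK2.
apply: (col K) => //; first exact: subset_trans KW (subsetDl _ _).
(* The colours of [f] on [K2] avoid [f v], so [K2] embeds in [#|K|] colours minus one. *)
have K2W w : w \in K2 -> [/\ w \in W :\ u & f w != f v].
  move=> wK; move/(subsetP KW2): (wK); rewrite !inE => /andP[wS wW].
  have wu : w != u by apply: contraNneq uK2 => <-.
  by rewrite wu wW; move: wS; rewrite wu wW.
have kpos : f v < #|K| := fK v vWu.
suff : #|K2| <= #|K|.-1 by rewrite -ltnS prednK // (leq_ltn_trans _ kpos).
(* The top colour is moved to the free colour [f v], which puts all values on [K2] below
   [#|K|.-1]. *)
pose g w := if f w == #|K|.-1 then f v else f w.
apply: (clique_leq (f := g)) => //.
  move=> w1 w2 w1K w2K w12 a12; have [w1W f1] := K2W _ w1K; have [w2W f2'] := K2W _ w2K.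
  have := pf _ _ w1W w2W w12 a12; rewrite /g.
  case: (eqVneq (f w1) #|K|.-1) => [E1|_]; case: (eqVneq (f w2) #|K|.-1) => [E2|_];
    rewrite ?E1 ?E2 ?eqxx //.
  by move=> _; rewrite eq_sym.
move=> w wK; have [wW fw] := K2W _ wK; have := fK w wW; rewrite /g.
by clear -kpos fw; case: (eqVneq (f w) #|K|.-1) => E lt; lia.
Qed.
End Perfect.

(** * Dominated pairs among the edges *)

Section Cells.
Variables (X Y : finType) (M : X -> Y -> bool).

Definition touch (a b : X * Y) := M a.1 b.2 || M b.1 a.2.

Lemma touchC : symmetric touch.
Proof. by move=> a b; rewrite /touch orbC. Qed.

Definition cells := [set a : X * Y | M a.1 a.2].

Lemma nested_onW (S : {set X}) c d z : nested_on M S c d -> z \in S -> M z c -> M z d.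
Proof. by move/nested_onP; apply. Qed.

Hypothesis simpleM : forall S : {set X}, S != set0 -> exists2 x, x \in S & simple_row M S x.

(** Without dominated pairs, the cells of [W] in simple rows would be pairwise untouching. Among the
    other rows some row [u] is simple; it meets the column of exactly one of those cells, and that
    cell dominates every cell of row [u], a contradiction. Covering ensures that the largest column
    of a simple row holds a cell of [W]. *)
Lemma exists_dominated_pair_covering (W : {set X * Y}) :
  (forall x c, M x c -> exists z, (z, c) \in W) -> W \subset cells -> 1 < #|W| ->
  exists u v, dominated_pair touch W u v.
Proof.
move=> cov Wc W1.
suff : ~ forall u v, ~~ dominated_pair touch W u v.
  move=> H; have [/existsP[u /existsP[v uv]]|no] :=
    boolP [exists u, exists v, dominated_pair touch W u v]; first by exists u, v.
  case: H => u v; apply: contra no => uv.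
  by apply/existsP; exists u; apply/existsP; exists v.
move=> nodom.
have MW a : a \in W -> M a.1 a.2 by move/(subsetP Wc); rewrite inE.
have nd a f : a \in W -> f \in W ->
    (forall w, w \in W -> w != a -> w != f -> touch a w -> touch f w) -> f = a.
  move=> aW fW H; apply/eqP; rewrite eq_sym; apply: contraNT (nodom a f) => af.
  exact/dominated_pairP.
pose R := [set a.1 | a in W].
have WR a : a \in W -> a.1 \in R by move=> aW; apply/imsetP; exists a.
(* Every simple row of [R] carries a unique cell [a] of [W]; its column is the
   largest one in that row, so that [a] touches exactly the rows of its column. *)
have mate1 x j f : simple_row M R x -> (x, j) \in W -> f \in W -> M x f.2 ->
    nested_on M R j f.2 -> f = (x, j).
  move=> /simple_rowP sx aW fW xf /nested_onP jf; apply: nd => // -[s t] wW _ _ /orP[/= xt|/= sj].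
    case/orP: (sx _ _ xt xf) => /nested_onP H; apply/orP.
      by right; apply: H (WR _ wW) (MW _ wW).
    by left; apply: H (WR _ fW) (MW _ fW).
  by apply/orP; right; apply: jf (WR _ wW) sj.
have mate2 x j c : simple_row M R x -> (x, j) \in W -> M x c -> nested_on M R c j.
  move=> sx aW xc; case/orP: (simple_rowP _ _ _ sx _ _ xc (MW _ aW)) => //= H.
  have [z zW] := cov _ _ xc; have := mate1 x j (z, c) sx aW zW xc H.
  by case=> _ ->; apply/nested_onP.
have mateE x j w : simple_row M R x -> (x, j) \in W -> w \in W ->
    touch (x, j) w = M w.1 j.
  move=> sx aW wW; rewrite /touch /=; case: (boolP (M x w.2)) => //= xw.
  by rewrite (nested_onW (mate2 x j _ sx aW xw)) ?WR ?MW.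
(* The column of [w] contains column [j], being the largest one in the row of [w]; hence [w] would
   dominate [(x, j)]. *)
have mate_eq x j w : simple_row M R x -> (x, j) \in W -> w \in W ->
    simple_row M R w.1 -> M w.1 j -> w = (x, j).
  case: w => s t sx aW wW /= ss sj; apply: nd => // w' w'W _ _.
  rewrite !mateE // => w'j.
  by apply: (nested_onW (mate2 s t j ss wW sj)); rewrite ?WR.
pose R' := [set x in R | ~~ simple_row M R x].
have R'R x : x \in R' -> x \in R by rewrite inE => /andP[].
have RX s : s \in R -> s \in R' \/ simple_row M R s.
  by move=> sR; have [|] := boolP (simple_row M R s); [right|left; rewrite inE sR].
(* If all rows are simple, no two distinct cells touch, and any two form a dominated pair. *)
have [R'0|/simpleM[u uR' su]] := eqVneq R' set0.
  have allS s : s \in R -> simple_row M R s by case/RX => //; rewrite R'0 inE.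
  have [a [b [aW bW ab]]] := card_gt1P W1.
  case/negP: (nodom a b); apply/dominated_pairP; split=> // -[s t] wW wa _ aw.
  case/eqP: wa; case: a aW aw ab => x j aW aw _.
  by apply: (mate_eq x j (s, t)); rewrite ?allS ?(WR _ aW) ?(WR _ wW) //
    -(mateE x j (s, t)) ?allS ?(WR _ aW).
have uR := R'R u uR'.
have /imsetP[[u' d] qW /= uE] := uR; subst u'.
(* If there were none, no simple row would meet a column [c] of [u]: the column of its cell contains
   [c] and would meet [u]. Inclusions over [R'] would then extend to [R], making [u] simple in
   [R]. *)
have [x [y [aW sx uy]]] : exists x y, [/\ (x, y) \in W, simple_row M R x & M u y].
  have [/existsP[[x y] /and3P[? ? ?]]|no] :=
    boolP [exists a : X * Y, [&& a \in W, simple_row M R a.1 & M u a.2]].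
    by exists x, y.
  suff : simple_row M R u by move: uR'; rewrite inE => /andP[_ /negP].
  have ext c c' : M u c -> nested_on M R' c c' -> nested_on M R c c'.
    move=> uc /nested_onP cc'; apply/nested_onP => s sR sc.
    case: (RX s sR) => [sR'|ss]; first exact: cc'.
    case/imsetP: sR => -[s' j] sW /= ?; subst s'.
    case/negP: no; apply/existsP; exists (s, j); rewrite sW ss /=.
    by apply: (nested_onW (mate2 s j c ss sW sc)).
  apply/simple_rowP => c c' uc uc'.
  by case/orP: (simple_rowP _ _ _ su _ _ uc uc') => H; apply/orP; [left|right]; apply: ext.
have claimE x1 y1 f : (x1, y1) \in W -> simple_row M R x1 -> f \in W ->
   M u f.2 -> nested_on M R' y1 f.2 -> f = (x1, y1).
  move=> a1W s1 fW uf /nested_onP H; apply: nd => // w wW wa wf; rewrite mateE // => wy.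
  case: (RX _ (WR _ wW)) => [wR'|ws]; first by rewrite /touch (H _ wR') ?orbT.
  by case/eqP: wa; apply: mate_eq.
have no2 s t : (s, t) \in W -> simple_row M R s -> M u t -> (s, t) = (x, y).
  move=> wW ss ut; case/orP: (simple_rowP _ _ _ su _ _ ut uy) => H.
    by apply/esym; apply: claimE.
  exact: claimE.
have below f : f \in W -> M u f.2 -> f != (x, y) -> nested_on M R' f.2 y.
  move=> fW uf fa; case/orP: (simple_rowP _ _ _ su _ _ uf uy) => // H.
  by case/eqP: fa; apply: claimE.
have ux : u != x by apply: contraTneq uR' => ->; rewrite inE sx andbF.
have qa : (u, d) != (x, y) by apply: contraNneq ux => -[-> _].
(* A neighbour of [(u, d)] in a row of [R'] meets [y], because there the columns of [u] lie below
   [y]. One in a simple row has a column meeting [u], so [no2] identifies it with [(x, y)]. *)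
case/negP: (nodom (u, d) (x, y)); apply/dominated_pairP; split=> // -[s t] wW wq wa.
have ud : M u d := MW _ qW.
case/orP => /= [ut|sd]; rewrite mateE //=.
  case: (RX _ (WR _ wW)) => [wR'|ws]; last by case/eqP: wa; apply: no2.
  exact: (nested_onW (below _ wW ut wa)) (MW _ wW).
case: (RX _ (WR _ wW)) => /= [wR'|ws].
  exact: (nested_onW (below _ qW ud qa)).
case/eqP: wa; apply: no2 => //.
by apply: (nested_onW (mate2 s t d ws wW sd)).
Qed.
End Cells.

(** Deleting the columns without a cell of [W] yields the covering hypothesis; simple rows stay
    simple, and touching within [W] does not change. *)
Lemma exists_dominated_pair (X Y : finType) (M : X -> Y -> bool) (W : {set X * Y}) :
  (forall S : {set X}, S != set0 -> exists2 x, x \in S & simple_row M S x) ->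
  W \subset cells M -> 1 < #|W| -> exists u v, dominated_pair (touch M) W u v.
Proof.
move=> simpleM Wc W1.
pose M' x c := M x c && (c \in [set a.2 | a in W]).
have WC a : a \in W -> a.2 \in [set a.2 | a in W] by move=> aW; apply/imsetP; exists a.
have [|||//|u [v /dominated_pairP[uW vW uv H]]] := @exists_dominated_pair_covering X Y M' _ W.
- move=> S /simpleM[x xS /simple_rowP sx]; exists x => //; apply/simple_rowP.
  move=> c d /andP[xc cC] /andP[xd dC].
  by case/orP: (sx _ _ xc xd) => /nested_onP H; apply/orP; [left|right];
     apply/nested_onP => z zS /andP[zc _]; rewrite /M' ?cC ?dC H.
- by move=> x c /andP[_ /imsetP[[z c'] zW /= ->]]; exists z.
- by apply/subsetP => a aW; move/(subsetP Wc): (aW); rewrite !inE /M' WC // => ->.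
exists u, v; apply/dominated_pairP; split=> // w wW wu wv.
by have := H w wW wu wv; rewrite /touch /M' !WC // !andbT.
Qed.

(** * Largest cliques of conflicting edges *)

Section Omega.
Variables (X Y : finType) (M : X -> Y -> bool).
Implicit Types (Z : {set X}) (K : {set X * Y}).

Definition row_clique Z K :=
  [&& K \subset cells M, [forall a in K, a.1 \in Z] & clique (touch M) K].

Lemma row_cliqueP Z K :
  reflect [/\ forall a, a \in K -> M a.1 a.2, forall a, a \in K -> a.1 \in Z &
              forall a b, a \in K -> b \in K -> touch M a b]
    (row_clique Z K).
Proof.
apply: (iffP and3P) => -[cK zK kK]; split.
- by move=> a /(subsetP cK); rewrite inE.
- exact/forall_inP.
- exact/cliqueP.
- by apply/subsetP => a /cK; rewrite inE.
- exact/forall_inP.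
- exact/cliqueP.
Qed.

Definition omega Z := \max_(K : {set X * Y} | row_clique Z K) #|K|.

Lemma row_clique_omega Z K : row_clique Z K -> #|K| <= omega Z.
Proof. by move=> gK; apply: (leq_bigmax_cond (F := fun K : {set X * Y} => #|K|)). Qed.

Lemma omega_attained Z : exists2 K, row_clique Z K & omega Z = #|K|.
Proof.
have g0 : row_clique Z set0 by apply/row_cliqueP; split=> a; rewrite ?inE // => b; rewrite inE.
have [|K gK E] := @eq_bigmax_cond _ (row_clique Z) (fun K : {set X * Y} => #|K|).
  by apply/card_gt0P; exists set0.
by exists K.
Qed.

Lemma omega0 : omega set0 = 0.
Proof.
have [K /row_cliqueP[_ K0 _] ->] := omega_attained set0.
by apply/eqP; rewrite cards_eq0; apply/eqP/setP => a; rewrite inE; apply/negP => /K0; rewrite inE.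
Qed.

Definition column Z c := [set z in Z | M z c].

Lemma columnP Z z c : (z \in column Z c) = (z \in Z) && M z c.
Proof. by rewrite inE. Qed.

Lemma nested_column Z c d : nested_on M Z c d = (column Z c \subset column Z d).
Proof.
apply/nested_onP/subsetP => H z.
  by rewrite !inE => /andP[zZ zc]; rewrite zZ H.
by move=> zZ zc; have := H z; rewrite !inE zZ zc => /(_ isT).
Qed.

(** For [i] simple, a column [d] containing [c] contributes row [i] and the rows that meet [d] but
    not [c]. Edges in the other rows meeting [c] are left to the clique number of those rows, so
    nothing is counted twice. *)
Definition gain Z i c :=
  \sum_(d | M i d && (#|column Z c| <= #|column Z d|)) (1 + #|column Z d| - #|column Z c|).

Section Step.
Variables (Z : {set X}) (i : X).
Hypotheses (iZ : i \in Z) (si : simple_row M Z i).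

Lemma simple_leq_sub c d : M i c -> M i d ->
  #|column Z c| <= #|column Z d| -> column Z c \subset column Z d.
Proof.
move=> ic id le; case/orP: (simple_rowP _ _ _ si _ _ ic id); rewrite nested_column // => sub.
have /eqP -> // : column Z d == column Z c by rewrite eqEcard sub.
Qed.

Let block c := [set a : X * Y | [&& M i a.2, #|column Z c| <= #|column Z a.2|, a.1 \in Z,
                   M a.1 a.2 & (a.1 == i) || ~~ M a.1 c]].

Lemma card_block c : M i c -> #|block c| = gain Z i c.
Proof.
move=> ic; have -> : #|block c| = \sum_d \sum_z (if (z, d) \in block c then 1 else 0).
  by rewrite exchange_big pair_bigA -sum1_card [LHS]big_mkcond /=; apply: eq_bigr => -[z d].
rewrite /gain [RHS]big_mkcond /=; apply: eq_bigr => d _.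
case: ifP => [/andP[id le]|no]; last first.
  by rewrite big1 // => z _; rewrite inE /= andbA no.
have sub := simple_leq_sub ic id le.
rewrite (bigD1 i) //= inE /= id le iZ eqxx /= -addnBA //; congr (_ + _).
rewrite -cardsDS // -sum1_card [RHS]big_mkcond /= [LHS]big_mkcond /=.
apply: eq_bigr => z _; rewrite !inE /= id le /=.
case: eqVneq => [->|zi] /=; first by rewrite iZ ic.
by case: (z \in Z); case: (M z d); case: (M z c).
Qed.

(** Every cell of [block c] lies in a column containing column [c], hence touches all cells in rows
    meeting [c]; two cells of [block c] touch because their columns are nested. *)
Lemma omega_ge c : M i c -> gain Z i c + omega (column (Z :\ i) c) <= omega Z.
Proof.
move=> ic; have [K /row_cliqueP[cK zK kK] ->] := omega_attained (column (Z :\ i) c).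
rewrite -card_block //.
have KZ a : a \in K -> [/\ a.1 != i, a.1 \in Z & M a.1 c].
  by move/zK; rewrite !inE => /andP[/andP[]].
have dis : [disjoint block c & K].
  apply/pred0P => a /=; apply/negP => /andP[]; rewrite inE => /and5P[_ _ _ _ H] /KZ[ai aZ ac].
  by move: H; rewrite (negbTE ai) ac.
rewrite -leq_card_setU in dis; rewrite -(eqP dis).
apply: row_clique_omega; apply/row_cliqueP.
have tBK a b : a \in block c -> b \in K -> touch M a b.
  rewrite inE => /and5P[ia le aZ aa _] /KZ[bi bZ bc].
  have /subsetP/(_ b.1) := simple_leq_sub ic ia le; rewrite !inE bZ bc => /(_ isT) ba.
  by apply/orP; right.
split=> [a|a|a b].
- by rewrite in_setU => /orP[|/cK //]; rewrite inE => /and5P[].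
- by rewrite in_setU => /orP[|/KZ[] //]; rewrite inE => /and5P[].
rewrite !in_setU => /orP[aB|aK] /orP[bB|bK].
- move: aB bB; rewrite !inE => /and5P[ia _ aZ aa _] /and5P[ib _ bZ bb _].
  by case/orP: (simple_rowP _ _ _ si _ _ ia ib) => H; apply/orP; [left|right];
    apply: (nested_onW H).
- exact: tBK.
- by rewrite touchC tBK.
- exact: kK.
Qed.

(** A member of the clique in a row avoiding [c] can touch [(i, c)] only through its own column. So
    that column meets [i], and it is not contained in column [c]: the member lies in [block c]. *)
Lemma omega_le : omega Z <=
  maxn (omega (Z :\ i)) (\max_(c | M i c) (gain Z i c + omega (column (Z :\ i) c))).
Proof.
have [K /row_cliqueP[cK zK kK] ->] := omega_attained Z.
have [/existsP[c0 c0K]|no] := boolP [exists c, (i, c) \in K]; last first.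
  rewrite leq_max; apply/orP; left; apply: row_clique_omega; apply/row_cliqueP; split=> // a aK.
  rewrite !inE zK // andbT; apply: contra no => /eqP ai.
  by apply/existsP; exists a.2; rewrite -ai -surjective_pairing.
case: (@arg_minnP _ c0 (fun c => (i, c) \in K) (fun c => #|column Z c|) c0K) => c iK cmin.
have ic : M i c := cK _ iK.
rewrite leq_max; apply/orP; right.
apply: leq_trans (leq_bigmax_cond (F := fun c => gain Z i c + omega (column (Z :\ i) c)) c ic).
rewrite -card_block //; pose L := [set a in K | (a.1 != i) && M a.1 c].
have sub : K \subset block c :|: L.
  apply/subsetP => a aK; rewrite in_setU [in X in _ || X]inE aK /=.
  case: (boolP ((a.1 != i) && _)); rewrite ?orbT // orbF negb_and negbK => H.
  rewrite inE H zK // cK //= andbT.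
  case/orP: H => [/eqP ai|nac].
    by rewrite -ai cK // cmin // -ai -surjective_pairing.
  have ia : M i a.2 by have := kK _ _ iK aK; rewrite /touch /= (negbTE nac) orbF.
  rewrite ia leqNgt /=; apply: contra nac => /ltnW/(simple_leq_sub ia ic)/subsetP/(_ a.1).
  by rewrite !inE zK // cK // => /(_ isT).
apply: leq_trans (subset_leq_card sub) _; apply: leq_trans (leq_card_setU _ _) _.
rewrite leq_add2l; apply: row_clique_omega; apply/row_cliqueP; split=> [a|a|a b].
- by rewrite inE => /andP[/cK].
- by rewrite !inE => /and3P[aK -> ->]; rewrite zK.
- by rewrite !inE => /andP[aK _] /andP[bK _]; apply: kK.
Qed.

Lemma omegaS Z1 Z2 : Z1 \subset Z2 -> omega Z1 <= omega Z2.
Proof.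
move=> /subsetP sub; have [K /row_cliqueP[cK zK kK] ->] := omega_attained Z1.
by apply: row_clique_omega; apply/row_cliqueP; split=> // a /zK /sub.
Qed.

Lemma omega_step : omega Z =
  maxn (omega (Z :\ i)) (\max_(c | M i c) (gain Z i c + omega (column (Z :\ i) c))).
Proof.
apply/eqP; rewrite eqn_leq omega_le geq_max omegaS ?subsetDl //=.
by apply/bigmax_leqP => c ic; apply: omega_ge.
Qed.

Lemma simple_row_column j : simple_row M (column Z j) i.
Proof.
apply/simple_rowP => c d ic id; case/orP: (simple_rowP _ _ _ si _ _ ic id) => H; apply/orP;
  [left|right]; apply/nested_onP => z; rewrite inE => /andP[zZ _]; exact: nested_onW H zZ.
Qed.

End Step.

Lemma column_column Z j d : column (column Z j) d = column Z j :&: column Z d.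
Proof. by apply/setP => z; rewrite !inE; case: (z \in Z). Qed.

(** This is the step for the rows of column [j], expressed by data of [Z]. Sizes become minima
    because the columns through [i] are nested; a column larger than [j] gives the same term as [j];
    and omitting row [i] is covered by the term for [c = j]. *)
Lemma omega_column Z i j : i \in Z -> simple_row M Z i -> M i j ->
  omega (column Z j) =
  \max_(c | M i c && (#|column Z c| <= #|column Z j|))
    (omega (column (Z :\ i) c) +
     \sum_(d | M i d && (#|column Z c| <= #|column Z d|))
       (1 + minn #|column Z d| #|column Z j| - #|column Z c|)).
Proof.
move=> iZ si ij; have iC : i \in column Z j by rewrite inE iZ.
have sC := simple_row_column si j.
have cm d : M i d -> #|column (column Z j) d| = minn #|column Z d| #|column Z j|.
  move=> id; rewrite column_column; case: (leqP #|column Z d| #|column Z j|) => le.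
    by rewrite (setIidPr _) // (simple_leq_sub si).
  by rewrite (setIidPl _) // (simple_leq_sub si) // ltnW.
have colD c : column Z c \subset column Z j ->
    column (column Z j :\ i) c = column (Z :\ i) c.
  move=> /subsetP sub; apply/setP => z; rewrite !inE; have := sub z; rewrite !inE.
  case: (z \in Z); case: (M z c); rewrite ?andbF //= => /(_ isT) ->.
  by rewrite andbT.
have term c : M i c -> #|column Z c| <= #|column Z j| ->
   gain (column Z j) i c + omega (column (column Z j :\ i) c) =
   omega (column (Z :\ i) c) +
     \sum_(d | M i d && (#|column Z c| <= #|column Z d|))
       (1 + minn #|column Z d| #|column Z j| - #|column Z c|).
  move=> ic le; rewrite addnC colD ?(simple_leq_sub si) //; congr (_ + _).
  rewrite /gain; apply: eq_big => [d|d /andP[id _]]; last first.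
    by rewrite !cm // (minn_idPl le).
  by case: (boolP (M i d)) => //= id; rewrite !cm // (minn_idPl le) leq_min le andbT.
apply/eqP; rewrite (omega_step iC sC) eqn_leq geq_max; apply/andP; split; last first.
  apply/bigmax_leqP => c /andP[ic le]; rewrite -term // leq_max; apply/orP; right.
  exact: (leq_bigmax_cond (F := fun c => gain (column Z j) i c + omega (column (column Z j :\ i) c)) c ic).
have tj c : M i c -> gain (column Z j) i c + omega (column (column Z j :\ i) c) <=
  \max_(c | M i c && (#|column Z c| <= #|column Z j|))
    (omega (column (Z :\ i) c) +
     \sum_(d | M i d && (#|column Z c| <= #|column Z d|))
       (1 + minn #|column Z d| #|column Z j| - #|column Z c|)).
  move=> ic; have [le|/ltnW le] := leqP #|column Z c| #|column Z j|.
    rewrite term //.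
    apply: (leq_bigmax_cond (F := fun c => omega (column (Z :\ i) c) +
     \sum_(d | M i d && (#|column Z c| <= #|column Z d|))
       (1 + minn #|column Z d| #|column Z j| - #|column Z c|))).
    by rewrite ic.
  have E : column (column Z j) c = column (column Z j) j.
    by rewrite !column_column setIid (setIidPl _) // (simple_leq_sub si).
  have -> : gain (column Z j) i c = gain (column Z j) i j by rewrite /gain E.
  have -> : column (column Z j :\ i) c = column (column Z j :\ i) j.
    apply/setP => z; move/setP/(_ z): E; rewrite !inE.
    by case: (z == i) => //=; rewrite !andbA => ->.
  rewrite term //.
  apply: (leq_bigmax_cond (F := fun c => omega (column (Z :\ i) c) +
     \sum_(d | M i d && (#|column Z c| <= #|column Z d|))
       (1 + minn #|column Z d| #|column Z j| - #|column Z c|))).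
  by rewrite ij leqnn.
apply/andP; split; last by apply/bigmax_leqP => c; apply: tj.
apply: leq_trans (tj j ij); apply: leq_trans (leq_addl _ _).
by apply: omegaS; apply/subsetP => z; rewrite !inE => /and3P[-> -> ->].
Qed.
End Omega.

(** * Strong edge colourings and cliques of touching pairs *)

Section Chromatic.
Variables (T : finType) (e : rel T).
Hypotheses (eS : simple_graph e) (eB : chordal_bipartite e).

(** For the lower bound, distinct touching pairs are distinct edges, as an edge would touch its
    reverse only through a loop. For the upper bound, each edge gets the colour of its orientation
    starting on the side [true]; with these orientations, conflicting edges touch. *)
Lemma strong_chromatic_index_omega : is_strong_chromatic_index e (omega e setT).
Proof.
have [eC eI] := eS; split; last first.
  move=> k [c [c1 c2]]; apply/bigmax_leqP => K /row_cliqueP[cK _ kK].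
  apply: (@clique_leq _ (touch e) K (fun a => c a.1 a.2)); first exact/cliqueP.
    move=> [x y] [u v] aK bK /= ab; rewrite /touch /= => t.
    have xy := cK _ aK; have uv := cK _ bK; apply: c2 => //=; last first.
      by case/orP: t => [-> |]; rewrite ?orbT // eC => ->; rewrite ?orbT.
    apply: contraNneq ab => E; rewrite /= in xy uv.
    have xE : x \in [set u; v] by rewrite -E !inE eqxx.
    have yE : y \in [set u; v] by rewrite -E !inE eqxx orbT.
    move: xE yE; rewrite !inE => /orP[]/eqP ? /orP[]/eqP ?; subst x y => //.
    - by rewrite (negbTE (eI _)) in xy.
    - by rewrite (negbTE (eI _)) (negbTE (eI _)) in t.
    - by rewrite (negbTE (eI _)) in xy.
  by move=> [x y] /cK /c1[].
have [|W' sW W1|K [f [KW cK pf fK]]] := @clique_coloring _ _ (touchC e) (cells e).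
- by move=> a; rewrite inE /touch => ->.
- by apply: exists_dominated_pair sW W1; apply: exists_simple_row.
have gK : row_clique e setT K.
  by rewrite /row_clique KW cK andbT; apply/forall_inP => a; rewrite inE.
have le := row_clique_omega gK.
have [[side sideP] _] := eB.
exists (fun x y => if side x then f (x, y) else f (y, x)).
have fO x y : e x y -> f (x, y) < omega e setT.
  by move=> xy; apply: leq_trans le; apply: fK; rewrite inE.
split=> [x y xy|x y u v xy uv ne con].
  have := sideP _ _ xy; case: (side x) (side y) => -[] // _; split=> //; apply: fO => //.
  by rewrite eC.
have sN a b : side a = side b -> e a b = false.
  by move=> E; apply/negP => /sideP; rewrite E eqxx.
have nE a b : side a != side b -> (a == b) = false.
  by move=> ab; apply: contraNF ab => /eqP->.
have main x' y' u' v' : e x' y' -> e u' v' -> side x' -> side u' ->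
    [set x'; y'] != [set u'; v'] ->
    [|| x' == u', x' == v', y' == u', y' == v', e x' u', e x' v', e y' u' | e y' v'] ->
    f (x', y') != f (u', v').
  move=> {}xy {}uv sx su {}ne {}con; apply: pf; rewrite ?inE //.
    by apply: contraNneq ne => -[-> ->].
  have := sideP _ _ xy; have := sideP _ _ uv; rewrite sx su /= => sv sy.
  rewrite /touch /=; case/or4P: con => [/eqP->|/eqP E|/eqP E|]; rewrite ?uv //.
  - by rewrite E in sx; rewrite sx in sv.
  - by rewrite E su in sy.
  case/or4P => [/eqP<-|||]; rewrite ?xy //.
  - by rewrite sN // sx su.
  - by move=> ->.
  - case/orP; first by rewrite eC => ->; rewrite orbT.
    by rewrite sN //; case: (side y') (side v') sy sv => -[].
have yx : e y x by rewrite eC.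
have vu : e v u by rewrite eC.
have := sideP _ _ xy; have := sideP _ _ uv.
case sx: (side x); case su: (side u) => sv sy.
- exact: main.
- apply: main => //.
  + by case: (side v) sv.
  + by rewrite [X in _ != X]setUC.
  + by case/or4P: con => [->|->|->|/or4P[->|->|->|/orP[->|->]]]; rewrite ?orbT.
- apply: main => //.
  + by case: (side y) sy.
  + by rewrite setUC.
  + by case/or4P: con => [->|->|->|/or4P[->|->|->|/orP[->|->]]]; rewrite ?orbT.
- apply: main => //.
  + by case: (side y) sy.
  + by case: (side v) sv.
  + by rewrite setUC [X in _ != X]setUC.
  + by case/or4P: con => [->|->|->|/or4P[->|->|->|/orP[->|->]]]; rewrite ?orbT.
Qed.
End Chromatic.

(** * Executions of the RAM *)

Section Runs.
Variable P : seq instr.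

Definition runs t p (m : nat -> nat) p' m' :=
  ram_run P t (RamState p m) = RamState p' m'.

Lemma runs_trans t1 t2 p1 m1 p2 m2 p3 m3 :
  runs t1 p1 m1 p2 m2 -> runs t2 p2 m2 p3 m3 -> runs (t1 + t2) p1 m1 p3 m3.
Proof. by rewrite /runs /ram_run addnC iterD => ->. Qed.

Definition code_at p l := forall i, i < size l -> nth IHalt P (p + i) = nth IHalt l i.

Lemma code_at_cat p l1 l2 :
  code_at p (l1 ++ l2) -> code_at p l1 /\ code_at (p + size l1) l2.
Proof.
move=> H; split=> i lti; first by rewrite H ?nth_cat ?lti // size_cat ltn_addr.
by rewrite -addnA H ?nth_cat ?size_cat ?ltn_add2l // ltnNge leq_addr /= addKn.
Qed.

Lemma code_at_cons p i l :
  code_at p (i :: l) -> nth IHalt P p = i /\ code_at p.+1 l.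
Proof.
move=> H; split; first by rewrite -{1}[p]addn0 (H 0).
by move=> j ltj; rewrite addSnnS (H j.+1).
Qed.

Definition straight i :=
  match i with IJz _ _ | IJmp _ | IHalt => false | _ => true end.

Definition eff (m : nat -> nat) i : nat -> nat :=
  match i with
  | IConst r k => upd m r k
  | IAdd r a b => upd m r (m a + m b)
  | ISub r a b => upd m r (m a - m b)
  | ILoad r a => upd m r (m (m a))
  | IStore a r => upd m (m a) (m r)
  | _ => m
  end.

Lemma runs_straight l p m : code_at p l -> all straight l ->
  runs (size l) p m (p + size l) (foldl eff m l).
Proof.
elim: l p m => [|i l IHl] p m; first by rewrite addn0.
case/code_at_cons => pi cl /= /andP[si sl]; rewrite -addSnnS -add1n.
apply: runs_trans (IHl _ _ cl sl).
by rewrite /runs /ram_run /ram_step /= pi; case: i si pi.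
Qed.

Lemma runs_jz p m r l : nth IHalt P p = IJz r l ->
  runs 1 p m (if m r == 0 then l else p.+1) m.
Proof. by move=> pi; rewrite /runs /ram_run /ram_step /= pi. Qed.

Lemma runs_jmp p m l : nth IHalt P p = IJmp l -> runs 1 p m l m.
Proof. by move=> pi; rewrite /runs /ram_run /ram_step /= pi. Qed.

End Runs.

Lemma updE m r v x : upd m r v x = if x == r then v else m x. Proof. by []. Qed.

(** * A small language with bounded loops, compiled to the RAM *)

Inductive expr : Type :=
  | ENum
  | EC of nat
  | EV of nat
  | EAdd of expr & expr
  | ESub of expr & expr
  | EA of nat & expr.

(** Every loop runs exactly [n] times, which makes the time bound syntactic; there is no unbounded
    iteration. *)
Inductive cmd : Type :=
  | CAss of nat & expr
  | CSto of nat & expr & expr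
  | CSeq of cmd & cmd
  | CIf of expr & cmd & cmd
  | CFor of nat & cmd.

Record store := Store { sc : nat -> nat; ar : nat -> nat -> nat }.

Definition set_sc s v k := Store (upd (sc s) v k) (ar s).
Definition set_ar s a i k :=
  Store (sc s) (fun b => if b == a then upd (ar s a) i k else ar s b).

Section Semantics.
Variable n : nat.

Fixpoint eval (s : store) (e : expr) : nat :=
  match e with
  | ENum => n
  | EC k => k
  | EV v => sc s v
  | EAdd e1 e2 => eval s e1 + eval s e2
  | ESub e1 e2 => eval s e1 - eval s e2
  | EA a e => ar s a (eval s e)
  end.

Fixpoint exec (c : cmd) (s : store) : store :=
  match c with
  | CAss v e => set_sc s v (eval s e)
  | CSto a e1 e2 => set_ar s a (eval s e1) (eval s e2)
  | CSeq c1 c2 => exec c2 (exec c1 s)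
  | CIf e c1 c2 => if eval s e == 0 then exec c2 s else exec c1 s
  | CFor x c => foldl (fun s i => exec c (set_sc s x i)) s (iota 0 n)
  end.

Lemma exec_for_ind (I : nat -> store -> Prop) x c s :
  I 0 s -> (forall i s', i < n -> I i s' -> I i.+1 (exec c (set_sc s' x i))) ->
  I n (exec (CFor x c) s).
Proof.
move=> I0 IS /=.
suff H k i s' : i + k <= n -> I i s' ->
    I (i + k) (foldl (fun s i => exec c (set_sc s x i)) s' (iota i k)).
  by apply: (H n 0 s).
elim: k i s' => [|k IHk] i s' le Ii /=; first by rewrite addn0.
rewrite -addSnnS; apply: IHk; first by rewrite addSnnS.
by apply: IS => //; apply: leq_trans le; rewrite -addSnnS leq_addr.
Qed.
End Semantics.

Fixpoint scalars (c : cmd) : seq nat :=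
  match c with
  | CAss v _ => [:: v]
  | CSto _ _ _ => [::]
  | CSeq c1 c2 | CIf _ c1 c2 => scalars c1 ++ scalars c2
  | CFor x c => x :: scalars c
  end.

Fixpoint arrays (c : cmd) : seq nat :=
  match c with
  | CAss _ _ => [::]
  | CSto a _ _ => [:: a]
  | CSeq c1 c2 | CIf _ c1 c2 => arrays c1 ++ arrays c2
  | CFor _ c => arrays c
  end.

Lemma exec_sc n c s v : v \notin scalars c -> sc (exec n c s) v = sc s v.
Proof.
elim: c s => [w e|a e1 e2|c1 IH1 c2 IH2|e c1 IH1 c2 IH2|x c IHc] s //=.
- by rewrite inE updE => /negbTE ->.
- by rewrite mem_cat negb_or => /andP[v1 v2]; rewrite IH2 ?IH1.
- by rewrite mem_cat negb_or => /andP[v1 v2]; case: eqP => _; rewrite ?IH1 ?IH2.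
rewrite inE negb_or => /andP[vx vc]; elim: (iota 0 n) s => //= i l IHl s.
by rewrite IHl IHc //= updE (negbTE vx).
Qed.

Lemma exec_ar n c s a : a \notin arrays c -> ar (exec n c s) a = ar s a.
Proof.
elim: c s => [w e|b e1 e2|c1 IH1 c2 IH2|e c1 IH1 c2 IH2|x c IHc] s //=.
- by rewrite inE => /negbTE ->.
- by rewrite mem_cat negb_or => /andP[v1 v2]; rewrite IH2 ?IH1.
- by rewrite mem_cat negb_or => /andP[v1 v2]; case: eqP => _; rewrite ?IH1 ?IH2.
by move=> ac; elim: (iota 0 n) s => //= i l IHl s; rewrite IHl IHc.
Qed.

(* Register 0 holds [n]; the others are split by residue modulo 16 between
   program variables, loop counters, temporaries and (residues 8 to 15) arrays. *)
Definition var v := 16 * v + 1.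
Definition ctr d := 16 * d + 2.
Definition tmp t := 16 * t + 3.
Definition slot a i := 16 * i + (8 + a).

Definition represents n (s : store) (m : nat -> nat) :=
  [/\ m 0 = n, forall v, m (var v) = sc s v &
      forall a i, a < 8 -> m (slot a i) = ar s a i].

(** Four doublings multiply the index by the stride 16, as the machine has no product. *)
Definition caddr a t :=
  nseq 4 (IAdd (tmp t) (tmp t) (tmp t)) ++
  [:: IConst (tmp t.+1) (8 + a); IAdd (tmp t) (tmp t) (tmp t.+1)].

Fixpoint cexpr (e : expr) (t : nat) : seq instr :=
  match e with
  | ENum => [:: IConst (tmp t) 0; IAdd (tmp t) (tmp t) 0]
  | EC k => [:: IConst (tmp t) k]
  | EV v => [:: IConst (tmp t) 0; IAdd (tmp t) (tmp t) (var v)]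
  | EAdd e1 e2 => cexpr e1 t ++ cexpr e2 t.+1 ++ [:: IAdd (tmp t) (tmp t) (tmp t.+1)]
  | ESub e1 e2 => cexpr e1 t ++ cexpr e2 t.+1 ++ [:: ISub (tmp t) (tmp t) (tmp t.+1)]
  | EA a e => cexpr e t ++ caddr a t ++ [:: ILoad (tmp t) (tmp t)]
  end.

Fixpoint wfe (e : expr) : bool :=
  match e with
  | EAdd e1 e2 | ESub e1 e2 => wfe e1 && wfe e2
  | EA a e => (a < 8) && wfe e
  | _ => true
  end.

Definition temp_free t x := forall u, t <= u -> x != tmp u.

Lemma temp_free_var t v : temp_free t (var v).
Proof. by move=> u _; rewrite /var /tmp; lia. Qed.
Lemma temp_free_ctr t v : temp_free t (ctr v).
Proof. by move=> u _; rewrite /ctr /tmp; lia. Qed.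
Lemma temp_free_slot t a i : a < 8 -> temp_free t (slot a i).
Proof. by move=> lta u _; rewrite /slot /tmp; lia. Qed.
Lemma temp_free0 t : temp_free t 0.
Proof. by move=> u _; rewrite /tmp; lia. Qed.
Lemma temp_free_tmp t u : u < t -> temp_free t (tmp u).
Proof. by move=> ltu w lew; rewrite /tmp; lia. Qed.
Lemma temp_freeS t x : temp_free t x -> temp_free t.+1 x.
Proof. by move=> H u /ltnW /H. Qed.

Lemma represents_temp n s m m' : represents n s m ->
  (forall x, temp_free 0 x -> m' x = m x) -> represents n s m'.
Proof.
move=> [m0 mv ma] H; split=> [|v|a i lta].
- by rewrite H //; apply: temp_free0.
- by rewrite H //; apply: temp_free_var.
- by rewrite H ?ma //; apply: temp_free_slot.
Qed.

Lemma cexpr_straight e t : all straight (cexpr e t).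
Proof.
by elim: e t => //= [e1 IH1 e2 IH2|e1 IH1 e2 IH2|a e IHe] t; rewrite !all_cat /= ?IH1 ?IH2 ?IHe.
Qed.

Lemma caddr_ok a t m : let m' := foldl eff m (caddr a t) in
  m' (tmp t) = slot a (m (tmp t)) /\ forall x, temp_free t x -> m' x = m x.
Proof.
have ne : tmp t == tmp t.+1 = false by rewrite /tmp; lia.
split=> [|x xt] /=; rewrite !updE ?eqxx ?ne /=; first by rewrite /slot; lia.
have x1 := negbTE (xt t (leqnn _)); have x2 := negbTE (xt t.+1 (leqnSn _)).
by rewrite !x1 !x2.
Qed.

Lemma cexpr_ok n s e t m : represents n s m -> wfe e ->
  let m' := foldl eff m (cexpr e t) in
  m' (tmp t) = eval n s e /\ forall x, temp_free t x -> m' x = m x.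
Proof.
have self u x : temp_free u x -> x == tmp u = false by move=> H; apply/negbTE/H.
have rec2 (e1 e2 : expr) : (forall t m, represents n s m -> wfe e1 ->
    let m' := foldl eff m (cexpr e1 t) in
    m' (tmp t) = eval n s e1 /\ forall x, temp_free t x -> m' x = m x) ->
  (forall t m, represents n s m -> wfe e2 ->
    let m' := foldl eff m (cexpr e2 t) in
    m' (tmp t) = eval n s e2 /\ forall x, temp_free t x -> m' x = m x) ->
  forall t m, represents n s m -> wfe e1 && wfe e2 ->
    let m' := foldl eff m (cexpr e1 t ++ cexpr e2 t.+1) in
    [/\ m' (tmp t) = eval n s e1, m' (tmp t.+1) = eval n s e2 &
        forall x, temp_free t x -> m' x = m x].
  move=> IH1 IH2 {}t {}m rm /andP[w1 w2] /=; rewrite foldl_cat.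
  have [E1 F1] := IH1 t m rm w1.
  have rm1 : represents n s (foldl eff m (cexpr e1 t)).
    apply: represents_temp rm _ => x x0; apply: F1 => u _; exact: x0.
  have [E2 F2] := IH2 t.+1 _ rm1 w2.
  split=> //; first by rewrite F2 ?E1 //; apply: temp_free_tmp.
  by move=> x xt; rewrite F2 ?F1 //; apply: temp_freeS.
elim: e t m => [|k|v|e1 IH1 e2 IH2|e1 IH1 e2 IH2|a e IHe] t m rm.
- case: rm => m0 _ _ _; split=> [|x xt] /=; last by rewrite !updE (self t x).
  by rewrite !updE eqxx (self t 0) ?m0 //; apply: temp_free0.
- by move=> _; split=> [|x xt] /=; [rewrite updE eqxx | rewrite updE (self t x)].
- case: rm => _ mv _ _; split=> [|x xt] /=; last by rewrite !updE (self t x).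
  by rewrite !updE eqxx (self t (var v)) ?mv //; apply: temp_free_var.
- move=> w; have [E1 E2 F] := rec2 _ _ IH1 IH2 t m rm w.
  rewrite /= catA foldl_cat /=; split; first by rewrite updE eqxx E1 E2.
  by move=> x xt; rewrite updE self // F.
- move=> w; have [E1 E2 F] := rec2 _ _ IH1 IH2 t m rm w.
  rewrite /= catA foldl_cat /=; split; first by rewrite updE eqxx E1 E2.
  by move=> x xt; rewrite updE self // F.
move=> /andP[lta we]; have [E F] := IHe t m rm we; cbv zeta.
have -> : foldl eff m (cexpr (EA a e) t) =
    eff (foldl eff (foldl eff m (cexpr e t)) (caddr a t)) (ILoad (tmp t) (tmp t)).
  rewrite (_ : cexpr (EA a e) t = cexpr e t ++ (caddr a t ++ [:: ILoad (tmp t) (tmp t)])) //.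
  by rewrite foldl_cat foldl_cat.
have [Ea Fa] := caddr_ok a t (foldl eff m (cexpr e t)).
split; last by move=> x xt; rewrite /eff updE self // Fa // F.
rewrite {1}/eff updE eqxx Ea E.
have tf u : temp_free u (slot a (eval n s e)) by apply: temp_free_slot.
by rewrite Fa // F //; case: rm => _ _ ->.
Qed.

(** [p] is the absolute address of the code, needed for jumps, and [d] the loop depth. A loop counts
    in [ctr d] and only copies the count to its variable, so the body cannot disturb it. Five
    instructions precede the body and three follow it. *)
Fixpoint compile (c : cmd) (p d : nat) : seq instr :=
  match c with
  | CAss v e => cexpr e 0 ++ [:: IConst (var v) 0; IAdd (var v) (var v) (tmp 0)]
  | CSto a e1 e2 =>
      cexpr e2 0 ++ cexpr e1 1 ++ caddr a 1 ++ [:: IStore (tmp 1) (tmp 0)]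
  | CSeq c1 c2 => let b := compile c1 p d in b ++ compile c2 (p + size b) d
  | CIf e c1 c2 =>
      let ce := cexpr e 0 in
      let b1 := compile c1 (p + size ce).+1 d in
      let p2 := ((p + size ce).+1 + size b1).+1 in
      let b2 := compile c2 p2 d in
      ce ++ IJz (tmp 0) p2 :: b1 ++ IJmp (p2 + size b2) :: b2
  | CFor x c =>
      let b := compile c (p + 5) d.+1 in
      IConst (ctr d) 0 ::
      [:: ISub (tmp 0) 0 (ctr d); IJz (tmp 0) (p + 5 + size b + 3);
          IConst (var x) 0; IAdd (var x) (var x) (ctr d)] ++
      b ++ [:: IConst (tmp 0) 1; IAdd (ctr d) (ctr d) (tmp 0); IJmp p.+1]
  end.

Fixpoint wfc (c : cmd) : bool :=
  match c with
  | CAss v e => wfe e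
  | CSto a e1 e2 => [&& a < 8, wfe e1 & wfe e2]
  | CSeq c1 c2 => wfc c1 && wfc c2
  | CIf e c1 c2 => [&& wfe e, wfc c1 & wfc c2]
  | CFor x c => wfc c
  end.

Fixpoint depth (c : cmd) : nat :=
  match c with
  | CSeq c1 c2 | CIf _ c1 c2 => maxn (depth c1) (depth c2)
  | CFor _ c => (depth c).+1
  | _ => 0
  end.

(** The coefficient of [n.+1 ^ depth c] in the running time. A loop adds 10: seven instructions per
    round, one to reset the counter and two for the last test. *)
Fixpoint cost (c : cmd) : nat :=
  match c with
  | CAss _ e => size (cexpr e 0) + 2
  | CSto a e1 e2 => size (cexpr e1 1) + size (cexpr e2 0) + 7
  | CSeq c1 c2 => cost c1 + cost c2
  | CIf e c1 c2 => size (cexpr e 0) + 2 + cost c1 + cost c2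
  | CFor _ c => cost c + 10
  end.

Lemma represents_set_sc n s m v k : represents n s m ->
  represents n (set_sc s v k) (upd m (var v) k).
Proof.
move=> [m0 mv ma]; split=> [|w|a i lta]; rewrite updE.
- by rewrite ifN ?m0 // /var; lia.
- by rewrite /= updE mv /var eqn_add2r eqn_pmul2l.
- by rewrite ifN ?ma // /var /slot; lia.
Qed.

Lemma represents_set_ar n s m a i k : a < 8 -> represents n s m ->
  represents n (set_ar s a i k) (upd m (slot a i) k).
Proof.
move=> lta [m0 mv ma]; split=> [|w|b j ltb]; rewrite updE.
- by rewrite ifN ?m0 // /slot; lia.
- by rewrite ifN ?mv // /var /slot; lia.
- rewrite /= ma //; case: (eqVneq b a) => [->|ba].
    by rewrite updE /slot eqn_add2r eqn_pmul2l.
  by rewrite ifN // /slot; lia.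
Qed.

Lemma represents_ext n s m m' : represents n s m ->
  (forall x, m' x = m x) -> represents n s m'.
Proof. by move=> rm H; apply: represents_temp rm _ => x _. Qed.

Lemma leq_exp_depth n k d d' : d <= d' -> k * n.+1 ^ d <= k * n.+1 ^ d'.
Proof. by move=> le; rewrite leq_mul2l leq_pexp2l ?orbT. Qed.

(** The clause on counters is there for the enclosing loops, whose counters have smaller depth and
    must survive the body. *)
Lemma compile_ok P n c p d s m : code_at P p (compile c p d) -> wfc c -> represents n s m ->
  exists t m', [/\ runs P t p m (p + size (compile c p d)) m',
    represents n (exec n c s) m', (forall d', d' < d -> m' (ctr d') = m (ctr d')) &
    t <= cost c * n.+1 ^ depth c].
Proof.
elim: c p d s m => [v e|a e1 e2|c1 IH1 c2 IH2|e c1 IH1 c2 IH2|x c IHc] p d s m.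
- move=> cd we rm; exists (size (compile (CAss v e) p d)), (foldl eff m (compile (CAss v e) p d)).
  have [E F] := cexpr_ok 0 rm we.
  split; first by apply: runs_straight => //=; rewrite all_cat cexpr_straight.
  + rewrite /= foldl_cat /=.
    have rm' : represents n s (foldl eff m (cexpr e 0)) by apply: represents_temp rm F.
    apply: represents_ext (represents_set_sc v (eval n s e) rm') _ => z.
    rewrite !updE eqxx; case: eqP => // _; rewrite ifN ?E //.
    by rewrite /tmp /var; lia.
  + move=> d' _; rewrite /= foldl_cat /= !updE ifN; last by rewrite /ctr /var; lia.
    by rewrite ifN ?F //; [apply: temp_free_ctr | rewrite /ctr /var; lia].
  + by rewrite /= size_cat muln1.
- move=> cd /= /and3P[lta w1 w2] rm.
  exists (size (compile (CSto a e1 e2) p d)), (foldl eff m (compile (CSto a e1 e2) p d)).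
  have [E2 F2] := cexpr_ok 0 rm w2.
  have rm2 : represents n s (foldl eff m (cexpr e2 0)) by apply: represents_temp rm F2.
  have [E1 F1] := cexpr_ok 1 rm2 w1.
  have [Ea Fa] := caddr_ok a 1 (foldl eff (foldl eff m (cexpr e2 0)) (cexpr e1 1)).
  have Ex : foldl eff m (compile (CSto a e1 e2) p d) =
      upd (foldl eff (foldl eff (foldl eff m (cexpr e2 0)) (cexpr e1 1)) (caddr a 1))
        (slot a (eval n s e1)) (eval n s e2).
    rewrite (_ : compile _ p d = cexpr e2 0 ++ (cexpr e1 1 ++ (caddr a 1 ++ [:: IStore (tmp 1) (tmp 0)]))) //.
    rewrite foldl_cat foldl_cat foldl_cat [LHS]/(eff _ _) /eff Ea E1.
    by rewrite Fa ?F1 ?E2 //; apply: temp_free_tmp.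
  split.
  + by apply: runs_straight => //=; rewrite all_cat cexpr_straight all_cat cexpr_straight.
  + rewrite Ex; apply: represents_set_ar => //.
    by apply: represents_temp rm _ => z z0; rewrite Fa ?F1 ?F2 // => u _; apply: z0.
  + move=> d' _; rewrite Ex updE ifN; last by rewrite /ctr /slot; lia.
    by rewrite Fa ?F1 ?F2 //; apply: temp_free_ctr.
  + by rewrite size_cat size_cat /= muln1; lia.
- move=> /= /code_at_cat[cd1 cd2] /andP[w1 w2] rm.
  have [t1 [m1 [R1 r1 f1 l1]]] := IH1 p d s m cd1 w1 rm.
  have [t2 [m2 [R2 r2 f2 l2]]] := IH2 _ d _ m1 cd2 w2 r1.
  exists (t1 + t2), m2; split=> //.
  + by rewrite size_cat addnA; apply: runs_trans R1 R2.
  + by move=> d' ltd; rewrite f2 ?f1.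
  + rewrite mulnDl; apply: leq_add.
      by apply: leq_trans l1 (leq_exp_depth _ _ _); apply: leq_maxl.
    by apply: leq_trans l2 (leq_exp_depth _ _ _); apply: leq_maxr.
- move=> /=; set ce := cexpr e 0; set b1 := compile c1 _ d; set p2 := ((p + size ce).+1 + size b1).+1.
  set b2 := compile c2 p2 d.
  move=> /code_at_cat[cde /code_at_cons[jz /code_at_cat[cd1 /code_at_cons[jm cd2]]]].
  move=> /and3P[we w1 w2] rm.
  have [E F] := cexpr_ok 0 rm we.
  have Re := runs_straight m cde (cexpr_straight e 0).
  have rm' : represents n s (foldl eff m ce) by apply: represents_temp rm F.
  have Rz := runs_jz (foldl eff m ce) jz.
  have size_if : p + size (ce ++ IJz (tmp 0) p2 :: b1 ++ IJmp (p2 + size b2) :: b2) = p2 + size b2.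
    by rewrite size_cat /= size_cat /= /p2; lia.
  have Fc d' : foldl eff m ce (ctr d') = m (ctr d') by rewrite F //; apply: temp_free_ctr.
  have pos k : 0 < n.+1 ^ k by rewrite expn_gt0.
  rewrite size_if; move: Rz; rewrite E; case: eqP => _ Rz.
  + have [t2 [m2 [R2 r2 f2 l2]]] := IH2 p2 d s _ cd2 w2 rm'.
    exists (size ce + 1 + t2), m2; split=> //.
    * by apply: runs_trans (runs_trans Re Rz) R2.
    * by move=> d' ltd; rewrite f2.
    * have := leq_trans l2 (leq_exp_depth n (cost c2) (leq_maxr (depth c1) (depth c2))).
      have := pos (maxn (depth c1) (depth c2)); move: (n.+1 ^ _) => N; clear; nia.
  + have [t1 [m1 [R1 r1 f1 l1]]] := IH1 _ d s _ cd1 w1 rm'.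
    exists (size ce + 1 + t1 + 1), m1; split=> //.
    * by apply: runs_trans (runs_trans (runs_trans Re Rz) R1) (runs_jmp _ jm).
    * by move=> d' ltd; rewrite f1.
    * have := leq_trans l1 (leq_exp_depth n (cost c1) (leq_maxl (depth c1) (depth c2))).
      have := pos (maxn (depth c1) (depth c2)); move: (n.+1 ^ _) => N; clear; nia.
move=> /=; set b := compile c (p + 5) d.+1.
case/code_at_cons => i0 /code_at_cons[i1 /code_at_cons[i2 /code_at_cons[i3 /code_at_cons[i4]]]].
have p5 : p.+4.+1 = p + 5 by lia.
rewrite p5.
case/code_at_cat => cb /code_at_cons[i5 /code_at_cons[i6 /code_at_cons[i7 _]]] wc rm.
have step q i : nth IHalt P q = i -> straight i -> forall m', runs P 1 q m' q.+1 (eff m' i).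
  by move=> qi si m'; rewrite /runs /ram_run /ram_step /= qi; case: i si qi.
have loop k j s' m' : j + k = n -> represents n s' m' -> m' (ctr d) = j ->
    exists t m'', [/\ runs P t p.+1 m' (p + 5 + size b + 3) m'',
      represents n (foldl (fun s i => exec n c (set_sc s x i)) s' (iota j k)) m'',
      (forall d', d' < d -> m'' (ctr d') = m' (ctr d')) &
      t <= k * (cost c * n.+1 ^ depth c + 7) + 2].
  elim: k j s' m' => [|k IHk] j s' m' jk rm' mj.
    have R1 := step _ _ i1 isT m'; have R2 := runs_jz (eff m' (ISub (tmp 0) 0 (ctr d))) i2.
    have m0 : m' 0 = n by case: rm'.
    have cond : eff m' (ISub (tmp 0) 0 (ctr d)) (tmp 0) == 0.
      by rewrite /= updE eqxx m0 mj -jk addn0 subnn.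
    rewrite cond in R2.
    exists (1 + 1), (eff m' (ISub (tmp 0) 0 (ctr d))); split=> //.
    * exact: runs_trans R1 R2.
    * apply: represents_temp rm' _ => z z0 /=; rewrite updE ifN //; exact: z0.
    * move=> d' ltd; rewrite /= updE ifN //; exact: (temp_free_ctr (t := 0)).
  have R1 := step _ _ i1 isT m'; have R2 := runs_jz (eff m' (ISub (tmp 0) 0 (ctr d))) i2.
  have m0 : m' 0 = n by case: rm'.
  have cond : eff m' (ISub (tmp 0) 0 (ctr d)) (tmp 0) != 0.
    by rewrite /= updE eqxx m0 mj; lia.
  rewrite (negbTE cond) in R2.
  have R3 := step _ _ i3 isT (eff m' (ISub (tmp 0) 0 (ctr d))).
  have R4 := step _ _ i4 isT (eff (eff m' (ISub (tmp 0) 0 (ctr d))) (IConst (var x) 0)).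
  set m4 := eff (eff (eff m' _) _) _ in R4.
  have r4 : represents n (set_sc s' x j) m4.
    have rt : represents n s' (upd m' (tmp 0) (m' 0 - m' (ctr d))).
      by apply: represents_temp rm' _ => z z0; rewrite updE ifN //; apply: z0.
    apply: represents_ext (represents_set_sc x j rt) _ => z.
    rewrite /m4 /= !updE eqxx; case: eqP => // _.
    rewrite ifN; last by rewrite /ctr /var; lia.
    by rewrite ifN ?mj // /ctr /tmp; lia.
  have f4 d' : m4 (ctr d') = m' (ctr d').
    rewrite /m4 /= !updE ifN; last by rewrite /ctr /var; lia.
    rewrite ifN; last by rewrite /ctr /var; lia.
    by rewrite ifN // /ctr /tmp; lia.
  have [t5 [m5 [R5 r5 f5 l5]]] := IHc (p + 5) d.+1 _ m4 cb wc r4.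
  have R6 := step _ _ i5 isT m5.
  have R7 := step _ _ i6 isT (eff m5 (IConst (tmp 0) 1)).
  set m7 := eff (eff m5 _) _ in R7.
  have r7 : represents n (exec n c (set_sc s' x j)) m7.
    case: r5 => u0 uv ua; split=> [|v|a i lta]; rewrite /m7 /= !updE.
    - by rewrite !ifN // /ctr /tmp; lia.
    - by rewrite !ifN // /ctr /tmp /var; lia.
    - by rewrite !ifN ?ua // /ctr /tmp /slot; lia.
  have c7 : m7 (ctr d) = j.+1.
    rewrite /m7 /= !updE eqxx ifN; last by rewrite /ctr /tmp; lia.
    by rewrite eqxx f5 // f4 mj addn1.
  have jk' : j.+1 + k = n by rewrite addSnnS.
  have [t8 [m8 [R8 r8 f8 l8]]] := IHk j.+1 _ m7 jk' r7 c7.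
  exists (1 + 1 + 1 + 1 + t5 + 1 + 1 + 1 + t8), m8; split=> //.
  * apply: runs_trans R8; apply: runs_trans (runs_jmp _ i7).
    apply: runs_trans R7; apply: runs_trans R6; apply: runs_trans R5.
    rewrite -p5; apply: runs_trans R4; apply: runs_trans R3; exact: runs_trans R1 R2.
  * move=> d' ltd; rewrite f8 // /m7 /= !updE ifN; last by rewrite /ctr; lia.
    rewrite ifN; last by rewrite /ctr /tmp; lia.
    by rewrite f5 ?f4 // ltnW.
  * by rewrite mulSn; move: l5 l8; clear; lia.
have R0 := step _ _ i0 isT m.
have r0 : represents n s (eff m (IConst (ctr d) 0)).
  case: rm => u0 uv ua; split=> [|v|a i lta]; rewrite /= !updE.
  - by rewrite !ifN // /ctr; lia.
  - by rewrite !ifN // /ctr /var; lia.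
  - by rewrite !ifN ?ua // /ctr /slot; lia.
have [|t [m' [R r f l]]] := loop n 0 s _ (add0n n) r0; first by rewrite /= updE eqxx.
exists (1 + t), m'; split=> //.
- rewrite size_cat /= (_ : p + _ = p + 5 + size b + 3) //; last by lia.
  exact: runs_trans R0 R.
- by move=> d' ltd; rewrite f //= updE ifN // /ctr; lia.
have pos : 0 < n.+1 ^ depth c by rewrite expn_gt0.
rewrite expnS; move: l pos; move: (n.+1 ^ _) => N; clear; nia.
Qed.

(** * Moving the input out of the low registers *)

(* Register 1 is the diagonal entry (0,0), hence free; it receives the bits held
   by registers 2 to 8 as a binary number, which frees these as well. *)
Definition pack : seq instr :=
  flatten [seq [:: IAdd 1 1 1; IAdd 1 1 r] | r <- iota 2 7].

(** Jump targets are absolute; [pack] occupies the addresses below 14. Register 4 becomes [n * n] by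
    repeated addition and then runs down to 9, entry [r] being copied to register [16 * r + 8],
    which is [slot 0 r]. Downwards, a target is always above the entries still to be read. *)
Definition move_input : seq instr :=
  [:: IConst 2 1; IConst 4 0; IConst 3 0; IAdd 3 3 0; IConst 5 8;
      IJz 3 23; IAdd 4 4 0; ISub 3 3 2; IJmp 19;
      ISub 6 4 5; IJz 6 36; IConst 6 0; IAdd 6 6 4;
      IAdd 6 6 6; IAdd 6 6 6; IAdd 6 6 6; IAdd 6 6 6; IAdd 6 6 5;
      ILoad 7 4; IStore 6 7; ISub 4 4 2; IJmp 23].

(** With 1 in register 2, truncated subtraction puts 1 into [dst] exactly when register 1 is at
    least [2 ^ j]. The bit is then doubled [j] times and subtracted, which removes the leading
    digit. *)
Definition unpack_bit j dst : seq instr :=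
  [:: IConst 3 (2 ^ j); ISub 6 3 1; ISub dst 2 6; IConst 7 0; IAdd 7 7 dst] ++
  nseq j (IAdd 7 7 7) ++ [:: ISub 1 1 7].

Fixpoint unpack k : seq instr :=
  if k is j.+1 then unpack_bit j (16 * (8 - j) + 8) ++ unpack j else [::].

(** Register 24 is [slot 0 1], the place of the diagonal entry (0,0), whose own register was reused
    for packing. *)
Definition boot : seq instr := pack ++ move_input ++ IConst 24 0 :: unpack 7.

(** The last [k] digits: register 2 is shifted in first and leads, register 8 is the unit digit. *)
Fixpoint packed (b : nat -> nat) k : nat :=
  if k is j.+1 then b (8 - j) * 2 ^ j + packed b j else 0.

Lemma packed_lt b k : (forall r, b r <= 1) -> packed b k < 2 ^ k.
Proof.
move=> b1; elim: k => //= k IHk; have := b1 (8 - k); rewrite expnS.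
move: (2 ^ k) (b _) (packed _ _) IHk => N u v; nia.
Qed.

Lemma pack_ok m : m 1 = 0 ->
  let m' := foldl eff m pack in
  m' 1 = packed m 7 /\ forall x, x != 1 -> m' x = m x.
Proof.
have H l m0 : 1 \notin l ->
    let m' := foldl eff m0 (flatten [seq [:: IAdd 1 1 1; IAdd 1 1 r] | r <- l]) in
    m' 1 = foldl (fun v r => 2 * v + m0 r) (m0 1) l /\ forall x, x != 1 -> m' x = m0 x.
  elim: l m0 => [|r l IHl] m0 //; rewrite inE negb_or => /andP[r1 l1].
  set m2 := eff (eff m0 (IAdd 1 1 1)) (IAdd 1 1 r).
  have [E F] := IHl m2 l1.
  have m2x x : x != 1 -> m2 x = m0 x by move=> x1; rewrite /m2 /= !updE (negbTE x1).
  have m21 : m2 1 = 2 * m0 1 + m0 r.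
    by rewrite /m2 /= !updE eqxx eq_sym (negbTE r1); lia.
  split; last by move=> x x1; rewrite /= F // m2x.
  rewrite /= E m21; move: (2 * m0 1 + m0 r) => v; clear -m2x l1.
  elim: l l1 v => //= q l IHl; rewrite inE negb_or => /andP[q1 l1] v.
  by rewrite m2x 1?eq_sym // IHl.
move=> m1; have [//|E F] := H (iota 2 7) m; split; last exact: F.
have -> : packed m 7 = m 2 * 64 + (m 3 * 32 + (m 4 * 16 + (m 5 * 8 +
    (m 6 * 4 + (m 7 * 2 + (m 8 * 1 + 0)))))) by [].
by rewrite E m1 /=; lia.
Qed.

Lemma doublings_ok j m : let m' := foldl eff m (nseq j (IAdd 7 7 7)) in
  m' 7 = m 7 * 2 ^ j /\ forall x, x != 7 -> m' x = m x.
Proof.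
elim: j m => [|j IHj] m /=; first by rewrite muln1.
have [E F] := IHj (upd m 7 (m 7 + m 7)); split.
  by rewrite E updE eqxx expnS; lia.
by move=> x x7; rewrite F // updE (negbTE x7).
Qed.

Lemma unpack_bit_ok j dst m b v : 7 < dst -> m 2 = 1 -> b <= 1 -> v < 2 ^ j ->
  m 1 = b * 2 ^ j + v ->
  let m' := foldl eff m (unpack_bit j dst) in
  [/\ m' dst = b, m' 1 = v & forall x, x \notin [:: 1; 3; 6; 7; dst] -> m' x = m x].
Proof.
move=> dst7 m2 b1 ltv m1; rewrite /unpack_bit.
rewrite foldl_cat foldl_cat; set m5 := foldl eff m _.
have [E F] := doublings_ok j m5; set m6 := foldl eff m5 _ in E F *.
have nd x : x < 8 -> (x == dst = false) * (dst == x = false).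
  by move=> ltx; split; apply/eqP; lia.
have nds := (nd 1 isT, nd 2 isT, nd 3 isT, nd 6 isT, nd 7 isT).
have m5d : m5 dst = b.
  rewrite /m5 /= /upd !nds eqxx /= ?nds m2 m1; move: b1 ltv; clear.
  by case: b => [|[|]] // _; lia.
have m57 : m5 7 = b.
  by rewrite -m5d /m5 /= /upd !nds eqxx /= ?nds.
have m5x x : x \notin [:: 3; 6; 7; dst] -> m5 x = m x.
  by rewrite !inE !negb_or => /and4P[a1 a2 a3 a4]; rewrite /m5 /= /upd !ifN.
split.
- by rewrite /= updE nds F // neq_ltn dst7 orbT.
- by rewrite /= updE /= E m57 F // m5x ?m1 ?addKn // !inE !nds.
move=> x; rewrite !inE !negb_or => /and5P[a1 a2 a3 a4 a5].
by rewrite /= updE ifN // F // m5x // !inE !negb_or a2 a3 a4 a5.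
Qed.

Lemma unpack_ok k m b : k <= 7 -> m 2 = 1 -> (forall r, b r <= 1) -> m 1 = packed b k ->
  let m' := foldl eff m (unpack k) in
  [/\ forall i, i < k -> m' (16 * (8 - i) + 8) = b (8 - i) &
      forall x, x \notin [:: 1; 3; 6; 7] -> (forall i, i < k -> x != 16 * (8 - i) + 8) ->
        m' x = m x].
Proof.
elim: k m => [|j IHj] m le7 m2 b1 m1; first by split.
have dst7 : 7 < 16 * (8 - j) + 8 by lia.
have [E1 E2 F] := unpack_bit_ok dst7 m2 (b1 _) (packed_lt j b1) m1.
have m2' : foldl eff m (unpack_bit j (16 * (8 - j) + 8)) 2 = 1 by rewrite F // !inE; lia.
have [|G1 G2] := IHj _ _ m2' b1 E2; first by lia.
split; rewrite /= -/(unpack j) foldl_cat.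
  move=> i; rewrite ltnS leq_eqVlt => /orP[/eqP->|]; last exact: G1.
  by rewrite G2 //; [rewrite !inE; lia | move=> i' lti; lia].
move=> x nx xi; rewrite G2 //; last by move=> i lti; apply: xi; lia.
rewrite F // !inE; move: nx (xi j (ltnSn j)); rewrite !inE; lia.
Qed.

Lemma code_at_slice P p l a b : code_at P p l -> code_at P (p + a) (take b (drop a l)).
Proof.
move=> cl; have [la|/drop_oversize->] := ltnP a (size l); last by [].
move: cl; rewrite -{1}(cat_take_drop a l) => /code_at_cat[_].
rewrite size_takel ?(ltnW la) // -{1}(cat_take_drop b (drop a l)).
by case/code_at_cat.
Qed.

Lemma square_loop P n i m : code_at P 14 move_input -> m 0 = n -> m 2 = 1 -> m 3 = i ->
  exists t m', [/\ runs P t 19 m 23 m', t <= 4 * i + 1, m' 4 = m 4 + i * n &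
    forall x, x != 3 -> x != 4 -> m' x = m x].
Proof.
move=> cd; have jz : nth IHalt P 19 = IJz 3 23 by exact: (cd 5).
have jm : nth IHalt P 22 = IJmp 19 by exact: (cd 8).
have cb : code_at P 20 [:: IAdd 4 4 0; ISub 3 3 2] := @code_at_slice P 14 _ 6 2 cd.
elim: i m => [|i IHi] m m0 m2 m3.
  have R := runs_jz m jz; rewrite m3 /= in R.
  by exists 1, m; split=> //; rewrite addn0.
have R1 := runs_jz m jz; rewrite m3 /= in R1.
have R2 := runs_straight m cb isT; have R3 := runs_jmp (foldl eff m [:: IAdd 4 4 0; ISub 3 3 2]) jm.
set m1 := foldl eff m _ in R2 R3.
have m1x x : x != 3 -> x != 4 -> m1 x = m x by move=> x3 x4; rewrite /m1 /= /upd !ifN.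
have m13 : m1 3 = i by rewrite /m1 /= /upd /= m3 m2 subn1.
have m14 : m1 4 = m 4 + n by rewrite /m1 /= /upd /= m0.
have [||t [m' [R lt E F]]] := IHi m1 _ _ m13; try by rewrite m1x.
exists (1 + 2 + 1 + t), m'; split.
- apply: runs_trans R; apply: runs_trans R3; exact: runs_trans R1 R2.
- lia.
- by rewrite E m14 mulSn addnA.
- by move=> x x3 x4; rewrite F // m1x.
Qed.

Lemma copy_loop P k m : code_at P 14 move_input -> m 2 = 1 -> m 5 = 8 -> m 4 = k ->
  exists t m', [/\ runs P t 23 m 36 m', t <= 13 * k + 2,
    forall r, 8 < r <= k -> m' (16 * r + 8) = m r &
    forall x, x \notin [:: 4; 6; 7] -> (forall r, 8 < r <= k -> x != 16 * r + 8) -> m' x = m x].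
Proof.
move=> cd; have jz : nth IHalt P 24 = IJz 6 36 by exact: (cd 10).
have jm : nth IHalt P 35 = IJmp 23 by exact: (cd 21).
have ct : code_at P 23 [:: ISub 6 4 5] := @code_at_slice P 14 _ 9 1 cd.
have ca := @code_at_slice P 14 _ 11 7 cd.
have cb : code_at P 32 [:: ILoad 7 4; IStore 6 7; ISub 4 4 2] := @code_at_slice P 14 _ 18 3 cd.
elim: k m => [|k IHk] m m2 m5 m4.
  have R1 := runs_straight m ct isT; have R2 := runs_jz (foldl eff m [:: ISub 6 4 5]) jz.
  have mt6 : foldl eff m [:: ISub 6 4 5] 6 = 0 by rewrite /= /upd /= m4 m5.
  rewrite mt6 /= in R2.
  exists (1 + 1), (foldl eff m [:: ISub 6 4 5]); split=> //.
  - by apply: runs_trans R1 R2.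
  - by move=> r; lia.
  - by move=> x; rewrite !inE !negb_or /= updE => /and3P[_ x6 _]; rewrite ifN.
have R1 := runs_straight m ct isT; have R2 := runs_jz (foldl eff m [:: ISub 6 4 5]) jz.
set mt := foldl eff m _ in R1 R2.
have mtx x : x != 6 -> mt x = m x by move=> x6; rewrite /mt /= /upd ifN.
have mt6 : mt 6 = k.+1 - 8 by rewrite /mt /= /upd /= m4 m5.
rewrite mt6 in R2.
have [le|gt] := leqP k.+1 8.
  exists (1 + 1), mt; split=> //.
  - by move: R2; rewrite (eqP le) => R2; apply: runs_trans R1 R2.
  - by lia.
  - by move=> r; lia.
  - by move=> x; rewrite !inE !negb_or => /and3P[_ x6 _] _; rewrite mtx.
rewrite ifN in R2; last by lia.
have R3 := runs_straight mt ca isT; rewrite /= in R3.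
set ma := upd _ 6 _ in R3.
have max x : x != 6 -> ma x = m x by move=> x6; rewrite /ma /upd !(negbTE x6) -mtx.
have ma6 : ma 6 = 16 * k.+1 + 8 by rewrite /ma /upd /= !mtx // m4 m5; lia.
clearbody ma.
have R4 := runs_straight ma cb isT; rewrite /= in R4.
set mb := upd _ 4 _ in R4.
have mbE x : mb x = if x == 4 then k else if x == 16 * k.+1 + 8 then m k.+1 else
                    if x == 7 then m k.+1 else ma x.
  have ma4 : ma 4 = k.+1 by rewrite max.
  have ma2 : ma 2 = 1 by rewrite max.
  have mak : ma k.+1 = m k.+1 by apply: max; lia.
  have d4 : 4 == 16 * k.+1 + 8 = false by apply/eqP; lia.
  have d2 : 2 == 16 * k.+1 + 8 = false by apply/eqP; lia.
  by rewrite /mb /upd /= ma6 d4 d2 ma4 ma2 mak subn1.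
have R5 := runs_jmp mb jm.
have mb2 : mb 2 = 1 by rewrite mbE /= ifN ?max //; lia.
have mb5 : mb 5 = 8 by rewrite mbE /= ifN ?max //; lia.
have mb4 : mb 4 = k by rewrite mbE.
have [t [m' [R lt E F]]] := IHk mb mb2 mb5 mb4.
exists (1 + 1 + 7 + 3 + 1 + t), m'; split.
- apply: runs_trans R; apply: runs_trans R5; apply: runs_trans R4.
  apply: runs_trans R3; exact: runs_trans R1 R2.
- by lia.
- move=> r /andP[r8]; rewrite leq_eqVlt => /orP[/eqP->|ltr].
    rewrite F ?mbE; first by rewrite ifN ?eqxx //; lia.
      by rewrite !inE; lia.
    by move=> r' lr'; lia.
  rewrite E ?r8 // mbE !ifN ?max //; lia.
- move=> x; rewrite !inE !negb_or => /and3P[x4 x6 x7] H.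
  rewrite F ?inE ?negb_or ?x4 ?x6 ?x7 // ?mbE; last by move=> r lr; apply: H; lia.
  by rewrite !ifN ?max //; apply: H; lia.
Qed.

Lemma constants_ok P m : code_at P 14 move_input ->
  exists m', [/\ runs P 5 14 m 19 m', m' 2 = 1, m' 3 = m 0 &
    [/\ m' 4 = 0, m' 5 = 8 & forall x, x \notin [:: 2; 3; 4; 5] -> m' x = m x]].
Proof.
move=> cd; have R := runs_straight m (@code_at_slice P 14 _ 0 5 cd) isT.
exists (foldl eff m (take 5 move_input)); split=> //; split=> // x.
by rewrite !inE !negb_or => /and4P[? ? ? ?]; rewrite /= /upd !ifN.
Qed.

Lemma boot_ok P n m : code_at P 0 boot -> m 0 = n -> m 1 = 0 -> (forall r, 0 < r -> m r <= 1) ->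
  exists t m', [/\ runs P t 0 m (size boot) m', m' 0 = n,
     forall k, 0 < k <= n * n -> m' (16 * k + 8) = m k &
     t <= 200 + 4 * n + 13 * (n * n)].
Proof.
move=> /code_at_cat[c1 /code_at_cat[c2 c3]] m0 m1 mb.
have [E1 F1] := pack_ok m1; have R1 := runs_straight m c1 isT.
set ma := foldl eff m pack in E1 F1 R1; clearbody ma.
have ma0 : ma 0 = n by rewrite F1.
have [mc [R2 mc2 mc3 [mc4 mc5 mcx]]] := constants_ok ma c2.
have mc0 : mc 0 = n by rewrite mcx.
rewrite ma0 in mc3.
have [t3 [md [R3 l3 E3 F3]]] := square_loop c2 mc0 mc2 mc3.
rewrite mc4 add0n in E3.
have [||t4 [me [R4 l4 E4 F4]]] := @copy_loop P (n * n) md c2 _ _ E3; rewrite ?F3 //.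
have R5 := runs_straight me c3 isT.
have FE i l : foldl eff me (i :: l) = foldl eff (eff me i) l by [].
rewrite FE [eff me _]/= in R5.
have me1 : me 1 = packed m 7 by rewrite F4 ?F3 ?mcx ?E1 //; lia.
have me2 : me 2 = 1 by rewrite F4 ?F3 //; lia.
(* Register 0 holds [n] and is no bit; replacing it by 0 makes the bound 1 hold everywhere. *)
pose b r := if r is 0 then 0 else m r.
have b1 r : b r <= 1 by case: r => // r; apply: mb.
have pk : packed m 7 = packed b 7 by [].
have [||G1 G2] := @unpack_ok 7 (upd me 24 0) b isT _ b1; first by rewrite updE /= me2.
  by rewrite updE /= me1 pk.
set mf := foldl eff _ _ in G1 G2.
exists (14 + 5 + t3 + t4 + size (IConst 24 0 :: unpack 7)), mf; split.
- apply: (runs_trans _ R5); apply: runs_trans R4; apply: runs_trans R3.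
  exact: runs_trans R1 R2.
- rewrite G2 // ?updE /=; last by move=> i; lia.
  by rewrite F4 ?F3 //; lia.
- move=> k /andP[k0 kn].
  have [k1|k1] := eqVneq k 1.
    rewrite k1 m1 G2 //; last by move=> i; lia.
  have [le|gt] := leqP k 8.
    have := G1 (8 - k); rewrite subKn // => ->; last by lia.
    by case: (k) k0.
  rewrite G2; first last.
  - by move=> i lti; lia.
  - by rewrite !inE; lia.
  rewrite updE ifN; last by lia.
  rewrite E4 ?gt // F3 ?mcx ?F1 //; rewrite ?inE; lia.
- rewrite [size _](_ : _ = 64) //; lia.
Qed.

(** * The program *)

Definition skip := CAss 15 (EC 0).
(** Truncated subtraction is the only test: it yields conjunction of bits and comparison here, and
    further on minima as [a - (a - b)] and maxima as [a + (b - a)]. *)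
Definition eand a b := ESub a (ESub (EC 1) b).
Definition ele a b := ESub (EC 1) (ESub a b).
(** Row offsets [1 + x * n] are tabulated since products are missing. The resulting index is the
    number of the input register of that matrix entry. *)
Definition entry x y := EAdd (EA 1 (EV x)) (EV y).
Definition edge x y := EA 0 (entry x y).

(* Scalars: 0 round, 1-4 vertices, 5 accumulator, 6 chosen row, 7 flag, 8 answer,
   9 bound, 10 result of [best_column], 11 current row, 12-14 columns.
   Arrays: 0 adjacency, 1 row offsets, 2 remaining rows, 3 non-inclusion table,
   4 elimination order, 5 clique numbers, 6 column sizes, 7 new clique numbers. *)
Definition init : cmd :=
  CSeq (CAss 5 (EC 1)) (CSeq (CAss 8 (EC 0))
  (CFor 1 (CSeq (CSto 1 (EV 1) (EV 5)) (CSeq (CAss 5 (EAdd (EV 5) ENum))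
    (CSeq (CSto 2 (EV 1) (EC 1)) (CSeq (CSto 5 (EV 1) (EC 0)) (CSto 6 (EV 1) (EC 0)))))))).

Definition not_included : cmd :=
  CSeq (CAss 5 (EC 0))
    (CFor 4 (CIf (eand (eand (EA 2 (EV 4)) (edge 4 2)) (ESub (EC 1) (edge 4 3)))
       (CAss 5 (EC 1)) skip)).

Definition inclusions : cmd :=
  CFor 2 (CFor 3 (CSeq not_included (CSto 3 (entry 2 3) (EV 5)))).

Definition check_row : cmd :=
  CSeq (CAss 7 (EC 1))
    (CFor 2 (CFor 3 (CIf (eand (eand (edge 1 2) (edge 1 3))
                               (eand (EA 3 (entry 2 3)) (EA 3 (entry 3 2))))
       (CAss 7 (EC 0)) skip))).

Definition choose_row : cmd :=
  CFor 1 (CIf (EA 2 (EV 1)) (CSeq check_row (CIf (EV 7) (CAss 6 (EV 1)) skip)) skip).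

(** The inclusion table depends on the remaining rows and is rebuilt in every round, at cubic cost;
    testing all rows against it is cubic too. *)
Definition eliminate : cmd :=
  CFor 0 (CSeq inclusions (CSeq choose_row
    (CSeq (CSto 4 (EV 0) (EV 6)) (CSto 2 (EV 6) (EC 0))))).

Definition add_gain : cmd :=
  CFor 14 (CIf (eand (edge 11 14) (ele (EA 6 (EV 13)) (EA 6 (EV 14))))
    (CAss 5 (EAdd (EV 5) (ESub (EAdd (EC 1)
       (ESub (EA 6 (EV 14)) (ESub (EA 6 (EV 14)) (EV 9)))) (EA 6 (EV 13)))))
    skip).

(** Scalar 9 is the size of the column to which the rows are restricted. The value [n] amounts to no
    restriction, so the same code evaluates both [omega_column] and the maximum in [omega_step]. *)
Definition best_column : cmd :=
  CSeq (CAss 10 (EC 0))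
    (CFor 13 (CIf (eand (edge 11 13) (ele (EA 6 (EV 13)) (EV 9)))
       (CSeq (CAss 5 (EA 5 (EV 13))) (CSeq add_gain
          (CAss 10 (EAdd (EV 10) (ESub (EV 5) (EV 10))))))
       skip)).

Definition count_row : cmd :=
  CFor 13 (CSto 6 (EV 13) (EAdd (EA 6 (EV 13)) (edge 11 13))).

Definition new_numbers : cmd :=
  CFor 12 (CIf (edge 11 12)
    (CSeq (CAss 9 (EA 6 (EV 12))) (CSeq best_column (CSto 7 (EV 12) (EV 10)))) skip).

(** Updating is delayed until here because every column of the row, and the answer as well, is
    computed from the old numbers. *)
Definition copy_numbers : cmd :=
  CFor 12 (CIf (edge 11 12) (CSto 5 (EV 12) (EA 7 (EV 12))) skip).

Definition dynamic : cmd :=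
  CFor 0 (CSeq (CAss 11 (EA 4 (ESub (ESub ENum (EC 1)) (EV 0))))
    (CSeq count_row (CSeq new_numbers
    (CSeq (CAss 9 ENum) (CSeq best_column
    (CSeq (CAss 8 (EAdd (EV 8) (ESub (EV 10) (EV 8)))) copy_numbers)))))).

Definition program : cmd := CSeq init (CSeq eliminate dynamic).

Lemma program_depth : depth program = 4. Proof. by []. Qed.
Lemma program_wf : wfc program. Proof. by []. Qed.

(** * Correctness of the program *)

Section Correctness.
Variables (n : nat) (e : rel 'I_n).

Local Notation run := (exec n).

Lemma exec_ass v ex s : run (CAss v ex) s = set_sc s v (eval n s ex). Proof. by []. Qed.
Lemma exec_skip s : run skip s = set_sc s 15 0. Proof. by []. Qed.
Lemma exec_sto a e1 e2 s : run (CSto a e1 e2) s = set_ar s a (eval n s e1) (eval n s e2).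
Proof. by []. Qed.
Lemma exec_seq c1 c2 s : run (CSeq c1 c2) s = run c2 (run c1 s). Proof. by []. Qed.
Lemma exec_if ex c1 c2 s :
  run (CIf ex c1 c2) s = if eval n s ex == 0 then run c2 s else run c1 s.
Proof. by []. Qed.
Lemma exec_if_bool ex c1 c2 s (b : bool) : eval n s ex = b ->
  run (CIf ex c1 c2) s = if b then run c1 s else run c2 s.
Proof. by move=> E; rewrite exec_if E; case: b E. Qed.

#[local] Opaque exec.

(** A loop rule with the frame built in: whatever the loop does not assign keeps its initial value,
    so invariants mention only what changes. *)
Lemma for_ind (I : nat -> store -> Prop) x c s :
  I 0 s ->
  (forall (i : 'I_n) s', (forall v, v \notin x :: scalars c -> sc s' v = sc s v) ->
      (forall a, a \notin arrays c -> ar s' a = ar s a) ->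
      I i s' -> I i.+1 (run c (set_sc s' x i))) ->
  [/\ I n (run (CFor x c) s),
      forall v, v \notin x :: scalars c -> sc (run (CFor x c) s) v = sc s v &
      forall a, a \notin arrays c -> ar (run (CFor x c) s) a = ar s a].
Proof.
move=> I0 IS.
pose J i s' := [/\ I i s', forall v, v \notin x :: scalars c -> sc s' v = sc s v &
  forall a, a \notin arrays c -> ar s' a = ar s a].
apply: (exec_for_ind (I := J)); first by split.
move=> i s' lti [Ii F1 F2]; split.
- exact: (IS (Ordinal lti)).
- move=> v nv; rewrite exec_sc; last by move: nv; rewrite inE negb_or => /andP[].
  by rewrite -F1 //= updE ifN //; move: nv; rewrite inE negb_or => /andP[].
- by move=> a na; rewrite exec_ar //= F2.
Qed.

Definition has_graph s :=
  (forall x : 'I_n, ar s 1 x = 1 + x * n) /\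
  (forall x y : 'I_n, ar s 0 (1 + x * n + y) = e x y).

Lemma eval_edge s v w (x y : 'I_n) : has_graph s -> sc s v = x -> sc s w = y ->
  eval n s (edge v w) = e x y.
Proof. by move=> [h1 h0] vx wy; rewrite /= vx wy h1 h0. Qed.

Lemma eval_entry s v w (x y : 'I_n) : has_graph s -> sc s v = x -> sc s w = y ->
  eval n s (entry v w) = 1 + x * n + y.
Proof. by move=> [h1 h0] vx wy; rewrite /= vx wy h1. Qed.

Lemma eval_and s a b (p q : bool) : eval n s a = p -> eval n s b = q ->
  eval n s (eand a b) = p && q.
Proof. by move=> /= -> ->; case: p q => -[]. Qed.

Lemma eval_not s a (p : bool) : eval n s a = p -> eval n s (ESub (EC 1) a) = ~~ p.
Proof. by move=> /= ->; case: p. Qed.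

Lemma eval_le s a b : eval n s (ele a b) = (eval n s a <= eval n s b).
Proof. by move=> /=; lia. Qed.

Lemma entry_inj (x y x' y' : 'I_n) :
  1 + x * n + y = 1 + x' * n + y' -> (x = x') /\ (y = y').
Proof.
move=> E; have lt := ltn_ord y; have lt' := ltn_ord y'.
have Ex : x = x' :> nat.
  have : (x * n + y) %/ n = (x' * n + y') %/ n by congr (_ %/ n); lia.
  by rewrite !divnMDl ?divn_small ?addn0 //; lia.
by split; apply: val_inj => //=; move: E; rewrite Ex; lia.
Qed.

Lemma has_graph_ar s s' : has_graph s -> ar s' 0 = ar s 0 -> ar s' 1 = ar s 1 -> has_graph s'.
Proof. by move=> [h1 h0] E0 E1; split=> [x|x y]; rewrite ?E0 ?E1. Qed.

Lemma big_ord_prefix (R : Type) (idx : R) (op : Monoid.com_law idx) (P : pred 'I_n)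
    (F : 'I_n -> R) (x : 'I_n) :
  \big[op/idx]_(c : 'I_n | (c < x.+1) && P c) F c =
  op (\big[op/idx]_(c : 'I_n | (c < x) && P c) F c) (if P x then F x else idx).
Proof.
rewrite (bigID (fun c : 'I_n => c < x)) /=; congr (op _ _).
  by apply: eq_bigl => c; case: (ltnP c x) => lt; rewrite ?andbF ?andbT // ltnW.
rewrite (eq_bigl (fun c => (c == x) && P c)) => [|c]; last first.
  by rewrite ltnS -leqNgt andbC andbA -eqn_leq eq_sym.
case: (boolP (P x)) => Px.
  by rewrite (big_pred1 x) // => c /=; case: eqP => // ->.
by rewrite big_pred0 // => c; case: eqP => // ->; rewrite (negbTE Px).
Qed.

Lemma exists_prefix (P : pred 'I_n) (x : 'I_n) :
  [exists c : 'I_n, (c < x.+1) && P c] = [exists c : 'I_n, (c < x) && P c] || P x.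
Proof.
apply/existsP/orP => [[c /andP[]]|[/existsP[c /andP[lt Pc]]|Px]].
- rewrite ltnS leq_eqVlt => /orP[/eqP/val_inj-> ?|lt Pc]; first by right.
  by left; apply/existsP; exists c; rewrite lt.
- by exists c; rewrite Pc andbT ltnW.
- by exists x; rewrite Px ltnSn.
Qed.

Lemma exists_prefix0 (P : pred 'I_n) : [exists c : 'I_n, (c < 0) && P c] = false.
Proof. by apply/existsP => -[c]. Qed.

Lemma exists_prefixn (P : pred 'I_n) : [exists c : 'I_n, (c < n) && P c] = [exists c, P c].
Proof. by apply: eq_existsb => c; rewrite ltn_ord. Qed.

Definition remaining (o : nat -> nat) k : {set 'I_n} :=
  [set x : 'I_n | val x \notin map o (iota 0 k)].

Definition has_rows (S : {set 'I_n}) s := forall x : 'I_n, ar s 2 x = (x \in S).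

Lemma not_included_ok S s (c d : 'I_n) : has_graph s -> has_rows S s ->
  sc s 2 = c -> sc s 3 = d ->
  sc (run not_included s) 5 = ~~ nested_on e S c d.
Proof.
move=> hg hS s2 s3; rewrite /not_included exec_seq exec_ass.
set s0 := set_sc _ _ _.
pose I k s' := sc s' 5 = [exists z : 'I_n, (z < k) && ((z \in S) && e z c && ~~ e z d)].
have [||E _ _] := @for_ind I 4 (CIf (eand (eand (EA 2 (EV 4)) (edge 4 2)) (ESub (EC 1) (edge 4 3)))
       (CAss 5 (EC 1)) skip) s0.
- by rewrite /I exists_prefix0.
- move=> z s' F1 F2; rewrite /I exists_prefix => E.
  have hg' : has_graph (set_sc s' 4 z) by apply: has_graph_ar hg _ _; rewrite /= F2.
  have E2 : sc (set_sc s' 4 z) 2 = c by rewrite /= updE /= F1.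
  have E3 : sc (set_sc s' 4 z) 3 = d by rewrite /= updE /= F1.
  have E4 : sc (set_sc s' 4 z) 4 = z by [].
  rewrite (@exec_if_bool _ _ _ _ ((z \in S) && e z c && ~~ e z d)); last first.
    apply: eval_and; last by apply: eval_not; apply: eval_edge.
    by apply: eval_and; [rewrite /= F2 //= hS | apply: eval_edge].
  by case: (_ && ~~ e z d); rewrite ?orbT ?orbF ?exec_ass ?exec_skip.
rewrite E exists_prefixn; congr (nat_of_bool _).
rewrite /nested_on negb_forall; apply: eq_existsb => z.
by case: (z \in S); case: (e z c); case: (e z d).
Qed.

Definition has_table (S : {set 'I_n}) s := forall c d : 'I_n,
  ar s 3 (1 + c * n + d) = ~~ nested_on e S c d.

Lemma inclusions_ok S s : has_graph s -> has_rows S s -> has_table S (run inclusions s).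
Proof.
move=> hg hS.
pose I k s' := forall c d : 'I_n, c < k -> ar s' 3 (1 + c * n + d) = ~~ nested_on e S c d.
have [||E _ _] := @for_ind I 2 (CFor 3 (CSeq not_included (CSto 3 (entry 2 3) (EV 5)))) s.
- by [].
- move=> c s1 F1 F2 I1.
  pose J k s' := forall c' d : 'I_n, c' < c \/ c' = c /\ d < k ->
    ar s' 3 (1 + c' * n + d) = ~~ nested_on e S c' d.
  have [||E _ _] := @for_ind J 3 (CSeq not_included (CSto 3 (entry 2 3) (EV 5))) (set_sc s1 2 c).
  + by move=> c' d [lt|[_ //]]; apply: I1.
  + move=> d s2 G1 G2 J2; rewrite exec_seq exec_sto.
    set s3 := set_sc s2 3 d.
    have s32 : sc s3 2 = c by rewrite /= updE /= G1.
    have hg3 : has_graph s3 by apply: has_graph_ar hg _ _; rewrite /= G2 //= F2.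
    have hS3 : has_rows S s3 by move=> x; rewrite /= G2 //= F2.
    have E5 := not_included_ok hg3 hS3 s32 (erefl (val d)).
    rewrite (@eval_entry _ _ _ c d); first last.
    * by rewrite exec_sc.
    * by rewrite exec_sc.
    * by apply: has_graph_ar hg3 _ _; rewrite exec_ar.
    move=> c' d' H; rewrite /= E5 updE; case: eqP => [/entry_inj[-> ->] //|ne].
    rewrite exec_ar //; apply: J2; case: H => [|[cc]]; first by left.
    rewrite ltnS leq_eqVlt => /orP[/eqP dd|]; last by right.
    by case: ne; rewrite cc dd.
  move=> c' d; rewrite ltnS leq_eqVlt => /orP[/eqP/val_inj cc|lt]; apply: E; last by left.
  by right.
by move=> c d; apply: E.
Qed.

Lemma check_row_ok S s (x : 'I_n) : has_graph s -> has_table S s -> sc s 1 = x ->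
  sc (run check_row s) 7 = simple_row e S x.
Proof.
move=> hg hT s1; rewrite /check_row exec_seq exec_ass; set s0 := set_sc _ _ _.
pose bad c d := [&& e x c, e x d, ~~ nested_on e S c d & ~~ nested_on e S d c].
pose I k s' := sc s' 7 = ~~ [exists c : 'I_n, (c < k) && [exists d, bad c d]].
set body := CIf _ _ _.
have [||E _ _] := @for_ind I 2 (CFor 3 body) s0.
- by rewrite /I exists_prefix0.
- move=> c sa F1 F2; rewrite /I exists_prefix => E.
  pose J k s' := sc s' 7 = ~~ ([exists c' : 'I_n, (c' < c) && [exists d, bad c' d]] ||
     [exists d : 'I_n, (d < k) && bad c d]).
  have [||E' _ _] := @for_ind J 3 body (set_sc sa 2 c).
  + by rewrite /J exists_prefix0 orbF.
  + move=> d sb G1 G2; rewrite /J exists_prefix => E'.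
    set st := set_sc sb 3 d.
    have st2 : sc st 2 = c by rewrite /= updE /= G1.
    have st3 : sc st 3 = d by [].
    have st1 : sc st 1 = x by rewrite /= updE /= G1 //= updE /= F1.
    have hgt : has_graph st by apply: has_graph_ar hg _ _; rewrite /= G2 //= F2.
    have st7 : sc st 7 = sc sb 7 by [].
    have tab a b (y z : 'I_n) : sc st a = y -> sc st b = z ->
        eval n st (EA 3 (entry a b)) = ~~ nested_on e S y z.
      move=> ya zb; rewrite [LHS]/(ar st 3 (eval n st (entry a b))) (eval_entry hgt ya zb).
      by rewrite /= G2 //= F2 //= hT.
    rewrite (@exec_if_bool _ _ _ _ (bad c d)); last first.
      by rewrite /bad andbA; apply: eval_and; apply: eval_and; (try exact: eval_edge); apply: tab.
    by case: (bad c d); rewrite ?orbT ?orbF ?exec_ass ?exec_skip.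
  by rewrite E' exists_prefixn.
rewrite E exists_prefixn; congr (nat_of_bool _).
rewrite negb_exists; apply: eq_forallb => c; rewrite negb_exists; apply: eq_forallb => d.
rewrite /bad; case: (e x c); case: (e x d) => //=.
by rewrite negb_and !negbK.
Qed.

Lemma choose_row_ok S s : has_graph s -> has_table S s -> has_rows S s ->
  (exists2 x, x \in S & simple_row e S x) ->
  exists x : 'I_n, [/\ sc (run choose_row s) 6 = x, x \in S & simple_row e S x].
Proof.
move=> hg hT hS [x0 x0S sx0].
(* Before a simple row has been met, scalar 6 is arbitrary; hence the invariant is conditional. *)
pose I k s' := (exists2 x : 'I_n, x < k & (x \in S) && simple_row e S x) ->
  exists x : 'I_n, [/\ sc s' 6 = x, x \in S & simple_row e S x].
have [||E _ _] := @for_ind I 1 (CIf (EA 2 (EV 1))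
  (CSeq check_row (CIf (EV 7) (CAss 6 (EV 1)) skip)) skip) s.
- by case.
- move=> x s1 F1 F2 I1 H; set st := set_sc s1 1 x.
  have st6 : sc st 6 = sc s1 6 by [].
  have hSt : has_rows S st by move=> y; rewrite /= F2.
  have E2 : eval n st (EA 2 (EV 1)) = (x \in S) by exact: hSt.
  have old : ~~ ((x \in S) && simple_row e S x) ->
      exists x : 'I_n, [/\ sc s1 6 = x, x \in S & simple_row e S x].
    move=> no; apply: I1; case: H => y; rewrite ltnS leq_eqVlt => /orP[/eqP/val_inj->|lt Sy].
      by rewrite (negbTE no).
    by exists y.
  have hgt : has_graph st by apply: has_graph_ar hg _ _; rewrite /= F2.
  have hTt : has_table S st by move=> c d; rewrite /= F2.
  have E7 := check_row_ok hgt hTt (erefl (val x)).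
  rewrite (exec_if_bool _ _ E2); case: (boolP (x \in S)) old => xS old; last first.
    by rewrite exec_skip; apply: old.
  rewrite exec_seq (@exec_if_bool (EV 7) _ _ _ _ E7).
  have F6 : sc (run check_row st) 6 = sc s1 6 by rewrite exec_sc.
  have F1' : sc (run check_row st) 1 = x by rewrite exec_sc.
  case: (boolP (simple_row e S x)) old => sx old; last first.
    by have [//|y [y6 yS sy]] := old; exists y; rewrite exec_skip -y6 -F6.
  by exists x; rewrite exec_ass -F1'.
by apply: E; exists x0; rewrite ?ltn_ord // x0S.
Qed.

Lemma remaining0 o : remaining o 0 = setT.
Proof. by apply/setP => x; rewrite !inE. Qed.

Lemma remainingS (o : nat -> nat) k (x : 'I_n) : o k = x -> remaining o k.+1 = remaining o k :\ x.
Proof.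
have E : iota 0 k.+1 = rcons (iota 0 k) k by rewrite -addn1 iotaD cats1.
move=> ok; rewrite /remaining E map_rcons ok; apply/setP => y.
by rewrite !inE mem_rcons inE negb_or.
Qed.

Lemma eq_remaining o o' k : (forall j, j < k -> o j = o' j) -> remaining o k = remaining o' k.
Proof.
move=> oo'; apply/setP => x; rewrite !inE; congr (_ \notin _).
by apply/eq_in_map => j; rewrite mem_iota add0n => /oo'.
Qed.

Definition eliminated (o : nat -> nat) k := forall j, j < k ->
  exists x : 'I_n, [/\ o j = x, x \in remaining o j & simple_row e (remaining o j) x].

Lemma card_remaining o k : eliminated o k -> #|remaining o k| + k = n.
Proof.
elim: k => [|k IHk] el; first by rewrite remaining0 cardsT card_ord addn0.
have [x [ok xr _]] := el k (ltnSn k).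
apply: etrans (IHk (fun j lt => el j (ltnW lt))).
by rewrite (remainingS ok) addnS (cardsD1 x (remaining o k)) xr.
Qed.

Hypothesis simple_exists : forall S : {set 'I_n}, S != set0 ->
  exists2 x, x \in S & simple_row e S x.

Lemma eliminate_ok s : has_graph s -> has_rows setT s ->
  eliminated (ar (run eliminate s) 4) n.
Proof.
move=> hg hS.
pose I k s' := eliminated (ar s' 4) k /\ has_rows (remaining (ar s' 4) k) s'.
have I0 : I 0 s by split=> [j|x] //; rewrite hS remaining0.
have [|[E _] _ _] // := @for_ind I 0 (CSeq inclusions (CSeq choose_row
    (CSeq (CSto 4 (EV 0) (EV 6)) (CSto 2 (EV 6) (EC 0))))) s I0.
move=> k s1 F1 F2 [el hR]; set st := set_sc s1 0 k; set S := remaining _ k in hR.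
have hgt : has_graph st by apply: has_graph_ar hg _ _; rewrite /= F2.
have hRt : has_rows S st by [].
have Sn0 : S != set0.
  have := card_remaining el; have := ltn_ord k; rewrite -card_gt0 -/S; lia.
rewrite !exec_seq !exec_sto; set sa := run inclusions st; set sb := run choose_row sa.
have hga : has_graph sa by apply: has_graph_ar hgt _ _; rewrite exec_ar.
have hRa : has_rows S sa by move=> x; rewrite exec_ar.
have hTa : has_table S sa by apply: inclusions_ok.
have [x [b6 xS sx]] := choose_row_ok hga hTa hRa (simple_exists Sn0).
have b0 : sc sb 0 = k by rewrite exec_sc // exec_sc.
have b4 : ar sb 4 = ar s1 4 by rewrite exec_ar // exec_ar.
have b2 : ar sb 2 = ar s1 2 by rewrite exec_ar // exec_ar.
rewrite -/sb in b6.
rewrite /I /= b6 b0 b4.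
have ext j : j <= k -> remaining (upd (ar s1 4) k x) j = remaining (ar s1 4) j.
  move=> lejk; apply: eq_remaining => i ltij; rewrite updE ifN //; lia.
have okx : upd (ar s1 4) k x k = x by rewrite updE eqxx.
split=> [j|y].
  rewrite ltnS leq_eqVlt => /orP[/eqP->|ltj].
    by exists x; rewrite ext // okx.
  have [y [oy yr sy]] := el j ltj.
  by exists y; rewrite ext ?(ltnW ltj) // updE ifN //; lia.
rewrite /= updE (remainingS okx) ext // in_setD1 b2 val_eqE.
by case: (eqVneq y x) => // _; rewrite hR.
Qed.

Definition gain_at cj (w : 'I_n -> nat) (i c : 'I_n) :=
  \sum_(d | e i d && (w c <= w d)) (1 + minn (w d) cj - w c).

Definition best_at cj (p w : 'I_n -> nat) (i : 'I_n) :=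
  \max_(c | e i c && (w c <= cj)) (p c + gain_at cj w i c).

Lemma add_gain_ok s cj (w : 'I_n -> nat) (i c : 'I_n) : has_graph s ->
  (forall d : 'I_n, ar s 6 d = w d) -> sc s 11 = i -> sc s 13 = c -> sc s 9 = cj ->
  sc (run add_gain s) 5 = sc s 5 + gain_at cj w i c.
Proof.
move=> hg hw s11 s13 s9.
pose I k s' := sc s' 5 = sc s 5 +
  \sum_(d : 'I_n | (d < k) && (e i d && (w c <= w d))) (1 + minn (w d) cj - w c).
set body := CIf (eand (edge 11 14) (ele (EA 6 (EV 13)) (EA 6 (EV 14)))) (CAss 5 (EAdd (EV 5) (ESub (EAdd (EC 1)
       (ESub (EA 6 (EV 14)) (ESub (EA 6 (EV 14)) (EV 9)))) (EA 6 (EV 13))))) skip.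
have [||E _ _] := @for_ind I 14 body s.
- by rewrite /I big_pred0 ?addn0.
- move=> d s1 F1 F2; rewrite /I big_ord_prefix => E; set st := set_sc s1 14 d.
  have hgt : has_graph st by apply: has_graph_ar hg _ _; rewrite /= F2.
  have t11 : sc st 11 = i by rewrite /= updE /= F1.
  have t13 : sc st 13 = c by rewrite /= updE /= F1.
  have t9 : sc st 9 = cj by rewrite /= updE /= F1.
  have t5 : sc st 5 = sc s1 5 by [].
  have t14 : sc st 14 = d by [].
  have tw (y : 'I_n) : ar st 6 y = w y by rewrite /= F2.
  have w13 : eval n st (EA 6 (EV 13)) = w c by rewrite -(tw c) -t13.
  have w14 : eval n st (EA 6 (EV 14)) = w d by rewrite -(tw d) -t14.
  rewrite (@exec_if_bool _ _ _ _ (e i d && (w c <= w d))); last first.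
    apply: eval_and; first exact: eval_edge.
    by rewrite eval_le w13 w14.
  case: (e i d && _); last by rewrite exec_skip /= addn0 -E.
  have E' : eval n st (EAdd (EV 5) (ESub (EAdd (EC 1)
      (ESub (EA 6 (EV 14)) (ESub (EA 6 (EV 14)) (EV 9)))) (EA 6 (EV 13)))) =
      sc s1 5 + (1 + (w d - (w d - cj)) - w c) by rewrite -t5 -w13 -w14 -t9.
  rewrite exec_ass E' /= updE eqxx E -addnA; congr (_ + (_ + _)).
  by rewrite /minn; case: ltnP; lia.
rewrite E /gain_at; congr (_ + _); apply: eq_bigl => d; by rewrite ltn_ord.
Qed.

Lemma best_column_ok s cj (p w : 'I_n -> nat) (i : 'I_n) : has_graph s ->
  (forall d : 'I_n, ar s 6 d = w d) -> (forall d : 'I_n, ar s 5 d = p d) ->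
  sc s 11 = i -> sc s 9 = cj ->
  sc (run best_column s) 10 = best_at cj p w i.
Proof.
move=> hg hw hp s11 s9; rewrite /best_column exec_seq exec_ass; set s0 := set_sc _ _ _.
pose I k s' := sc s' 10 =
  \max_(c : 'I_n | (c < k) && (e i c && (w c <= cj))) (p c + gain_at cj w i c).
set body := CIf _ _ _.
have [||E _ _] := @for_ind I 13 body s0.
- by rewrite /I big_pred0.
- move=> c s1 F1 F2; rewrite /I big_ord_prefix => E; set st := set_sc s1 13 c.
  have hgt : has_graph st by apply: has_graph_ar hg _ _; rewrite /= F2.
  have t11 : sc st 11 = i by rewrite /= updE /= F1.
  have t13 : sc st 13 = c by [].
  have t9 : sc st 9 = cj by rewrite /= updE /= F1.
  have t10 : sc st 10 = sc s1 10 by [].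
  have tw (y : 'I_n) : ar st 6 y = w y by rewrite /= F2 //= hw.
  have tp (y : 'I_n) : ar st 5 y = p y by rewrite /= F2 //= hp.
  have w13 : eval n st (EA 6 (EV 13)) = w c by rewrite -(tw c) -t13.
  rewrite (@exec_if_bool _ _ _ _ (e i c && (w c <= cj))); last first.
    apply: eval_and; first exact: eval_edge.
    by rewrite eval_le w13 [eval _ _ (EV 9)]t9.
  case: (e i c && _); last by rewrite exec_skip /= maxn0 -E.
  rewrite !exec_seq !exec_ass; set sg := set_sc st 5 _.
  have E5 : sc (run add_gain sg) 5 = sc sg 5 + gain_at cj w i c.
    by apply: add_gain_ok => //; apply: has_graph_ar hgt _ _.
  have g5 : sc sg 5 = p c by rewrite -(tp c).
  set sh := run add_gain sg in E5 *.
  have h10 : sc sh 10 = sc s1 10 by rewrite exec_sc.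
  have E' : eval n sh (EAdd (EV 10) (ESub (EV 5) (EV 10))) =
      sc s1 10 + (p c + gain_at cj w i c - sc s1 10) by rewrite -h10 -g5 -E5.
  by rewrite E' /= updE eqxx E maxnE.
rewrite E /best_at; apply: eq_bigl => d; by rewrite ltn_ord.
Qed.
Lemma ord_eqE (a b : 'I_n) : (nat_of_ord a == nat_of_ord b) = (a == b). Proof. by []. Qed.

Lemma count_row_ok s (w : 'I_n -> nat) (i : 'I_n) : has_graph s ->
  (forall d : 'I_n, ar s 6 d = w d) -> sc s 11 = i ->
  forall d : 'I_n, ar (run count_row s) 6 d = w d + e i d.
Proof.
move=> hg hw s11.
pose I k s' := forall d : 'I_n, ar s' 6 d = w d + ((d < k) && e i d).
have [||E _ _ d] := @for_ind I 13 (CSto 6 (EV 13) (EAdd (EA 6 (EV 13)) (edge 11 13))) s.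
- by move=> d; rewrite addn0.
- move=> c s1 F1 F2 I1 d; rewrite exec_sto; set st := set_sc s1 13 c.
  have hgt : has_graph st by apply: has_graph_ar hg _ _; rewrite /= F2.
  have t11 : sc st 11 = i by rewrite /= updE /= F1.
  have t13 : sc st 13 = c by [].
  have E : eval n st (EAdd (EA 6 (EV 13)) (edge 11 13)) = w c + e i c.
    rewrite -(eval_edge hgt t11 t13) [LHS]/(ar s1 6 c + eval n st (edge 11 13)) I1.
    by rewrite ltnn addn0.
  rewrite E [eval _ _ _]t13 /= updE ord_eqE; case: (eqVneq d c) => [->|ne].
    by rewrite ltnSn.
  by rewrite I1 ltnS [d <= c]leq_eqVlt ord_eqE (negbTE ne).
by rewrite E ltn_ord.
Qed.

Lemma new_numbers_ok s (p w : 'I_n -> nat) (i : 'I_n) : has_graph s ->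
  (forall d : 'I_n, ar s 6 d = w d) -> (forall d : 'I_n, ar s 5 d = p d) -> sc s 11 = i ->
  forall j : 'I_n, e i j -> ar (run new_numbers s) 7 j = best_at (w j) p w i.
Proof.
move=> hg hw hp s11.
pose I k s' := forall j : 'I_n, j < k -> e i j -> ar s' 7 j = best_at (w j) p w i.
have [||E _ _ j] := @for_ind I 12 (CIf (edge 11 12)
    (CSeq (CAss 9 (EA 6 (EV 12))) (CSeq best_column (CSto 7 (EV 12) (EV 10)))) skip) s.
- by [].
- move=> c s1 F1 F2 I1 j; set st := set_sc s1 12 c.
  have hgt : has_graph st by apply: has_graph_ar hg _ _; rewrite /= F2.
  have t11 : sc st 11 = i by rewrite /= updE /= F1.
  have t12 : sc st 12 = c by [].
  have tw (y : 'I_n) : ar st 6 y = w y by rewrite /= F2.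
  have tp (y : 'I_n) : ar st 5 y = p y by rewrite /= F2.
  rewrite (exec_if_bool _ _ (eval_edge hgt t11 t12)) ltnS leq_eqVlt ord_eqE.
  case: (boolP (e i c)) => ic; last first.
    rewrite exec_skip => /orP[/eqP->|lt]; first by rewrite (negbTE ic).
    exact: I1.
  rewrite exec_seq exec_seq exec_sto exec_ass; set sg := set_sc st 9 _.
  have g9 : sc sg 9 = w c by rewrite -(tw c).
  have gw (y : 'I_n) : ar sg 6 y = w y by rewrite -(tw y).
  have gp (y : 'I_n) : ar sg 5 y = p y by rewrite -(tp y).
  have hgg : has_graph sg by apply: has_graph_ar hgt _ _.
  have E10 := best_column_ok hgg gw gp (t11 : sc sg 11 = i) g9.
  have E12 : sc (run best_column sg) 12 = c by rewrite exec_sc.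
  rewrite [ar _ 7]/= !E10 E12 updE ord_eqE; case: (eqVneq j c) => [->//|ne] /= lt.
  by rewrite exec_ar //; apply: I1.
by apply: E.
Qed.

Lemma copy_numbers_ok s (i : 'I_n) : has_graph s -> sc s 11 = i ->
  forall j : 'I_n, ar (run copy_numbers s) 5 j = if e i j then ar s 7 j else ar s 5 j.
Proof.
move=> hg s11.
pose I k s' := forall j : 'I_n, ar s' 5 j = if (j < k) && e i j then ar s 7 j else ar s 5 j.
have [||E _ _ j] := @for_ind I 12 (CIf (edge 11 12) (CSto 5 (EV 12) (EA 7 (EV 12))) skip) s.
- by [].
- move=> c s1 F1 F2 I1 j; set st := set_sc s1 12 c.
  have hgt : has_graph st by apply: has_graph_ar hg _ _; rewrite /= F2.
  have t11 : sc st 11 = i by rewrite /= updE /= F1.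
  have t12 : sc st 12 = c by [].
  rewrite (exec_if_bool _ _ (eval_edge hgt t11 t12)) ltnS leq_eqVlt ord_eqE.
  case: (boolP (e i c)) => ic; last first.
    rewrite exec_skip [LHS]I1; case: (eqVneq j c) => [->|//].
    by rewrite (negbTE ic) !andbF.
  have E7 : eval n st (EA 7 (EV 12)) = ar s 7 c by rewrite -[LHS]/(ar s1 7 c) F2.
  rewrite exec_sto E7 [eval _ _ _]t12 /= updE ord_eqE.
  by case: (eqVneq j c) => [->|_]; rewrite ?ic ?I1.
by rewrite E ltn_ord.
Qed.

Lemma dynamic_ok s : has_graph s -> eliminated (ar s 4) n ->
  (forall d : 'I_n, ar s 5 d = 0) -> (forall d : 'I_n, ar s 6 d = 0) -> sc s 8 = 0 ->
  sc (run dynamic s) 8 = omega e setT.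
Proof.
move=> hg el s5 s6 s8; set o := ar s 4 in el.
(* Rows come back in reverse order, so the row added in a round is simple in the set that it
   completes. *)
pose I t s' := let Z := remaining o (n - t) in
  [/\ forall c : 'I_n, ar s' 5 c = omega e (column e Z c),
      forall c : 'I_n, ar s' 6 c = #|column e Z c| & sc s' 8 = omega e Z].
have r0 : remaining o n = set0.
  by apply/eqP; rewrite -cards_eq0; have := card_remaining el; lia.
have c0 d : column e set0 d = set0 by apply/setP => x; rewrite !inE.
have I0 : I 0 s.
  by rewrite /I subn0 r0; split=> [d|d|]; rewrite ?c0 ?omega0 ?cards0.
have [|[_ _ E] _ _] := @for_ind I 0 (CSeq (CAss 11 (EA 4 (ESub (ESub ENum (EC 1)) (EV 0))))
    (CSeq count_row (CSeq new_numbers (CSeq (CAss 9 ENum) (CSeq best_column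
    (CSeq (CAss 8 (EAdd (EV 8) (ESub (EV 10) (EV 8)))) copy_numbers)))))) s I0; last first.
  by rewrite E subnn remaining0.
move=> t s1 F1 F2 [I5 I6 I8].
have ltt := ltn_ord t; pose k := n - t.+1.
have kS : n - t = k.+1 by rewrite /k; lia.
have [|i [ok iZ si]] := el k; first by rewrite /k; lia.
rewrite kS (remainingS ok) in I5 I6 I8.
rewrite /I -/k; set Z := remaining o k in iZ si I5 I6 I8 *.
do 6! rewrite exec_seq; rewrite !exec_ass.
set s2 := set_sc (set_sc s1 0 t) 11 _.
have hg2 : has_graph s2 by apply: has_graph_ar hg _ _; rewrite /= F2.
have s2_11 : sc s2 11 = i.
  rewrite -ok /s2 /= !updE /= F2 // -/o; congr o; rewrite /k; lia.
have s2_5 d : ar s2 5 d = ar s1 5 d by [].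
have s2_6 (d : 'I_n) : ar s2 6 d = #|column e (Z :\ i) d| by rewrite -I6.
have C6 := count_row_ok hg2 s2_6 s2_11; set s3 := run count_row s2 in C6 *.
have s3_11 : sc s3 11 = i by rewrite exec_sc.
have hg3 : has_graph s3 by apply: has_graph_ar hg2 _ _; rewrite exec_ar.
pose w (c : 'I_n) := #|column e Z c|.
have s3_6 (d : 'I_n) : ar s3 6 d = w d.
  rewrite C6 /w (cardsD1 i (column e Z d)) columnP iZ addnC; congr (_ + _).
  by congr #|pred_of_set _|; apply/setP => z; rewrite !inE; case: (z == i).
pose p (c : 'I_n) := omega e (column e (Z :\ i) c).
have s3_5 (d : 'I_n) : ar s3 5 d = p d by rewrite exec_ar //= I5.
have N7 := new_numbers_ok hg3 s3_6 s3_5 s3_11; set s4 := run new_numbers s3 in N7 *.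
have hg4 : has_graph s4 by apply: has_graph_ar hg3 _ _; rewrite exec_ar.
set s5' := set_sc s4 9 _.
have s5_9 : sc s5' 9 = n by [].
have s5_11 : sc s5' 11 = i by rewrite /= updE /= exec_sc.
have s5_8 : sc s5' 8 = omega e (Z :\ i).
  by rewrite /= updE /= exec_sc //= exec_sc //= /s2 /= !updE.
have s5_5 (d : 'I_n) : ar s5' 5 d = p d by rewrite /= exec_ar.
have s5_6 (d : 'I_n) : ar s5' 6 d = w d by rewrite /= exec_ar.
have hg5 : has_graph s5' by apply: has_graph_ar hg4 _ _.
have B10 := best_column_ok hg5 s5_6 s5_5 s5_11 s5_9; set s6' := run best_column s5' in B10 *.
have s6_8 : sc s6' 8 = omega e (Z :\ i) by rewrite exec_sc.
set s7 := set_sc s6' 8 _.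
have s7_8 : sc s7 8 = maxn (omega e (Z :\ i)) (best_at n p w i).
  by rewrite maxnE -s6_8 -B10.
have s7_11 : sc s7 11 = i by rewrite /= updE /= exec_sc.
have hg7 : has_graph s7 by apply: has_graph_ar hg5 _ _; rewrite /= exec_ar.
have C5 := copy_numbers_ok hg7 s7_11; set s8' := run copy_numbers s7 in C5 *.
(* With bound [n], all minima in [best_at] are plain column sizes, which turns it into the maximum
   of [omega_step]. *)
have wn d : w d <= n by rewrite -[n in _ <= n]card_ord max_card.
have nadj (d : 'I_n) : ~~ e i d -> column e Z d = column e (Z :\ i) d.
  move=> nd; apply/setP => z; rewrite !inE; case: (eqVneq z i) => [->|//].
  by rewrite (negbTE nd) andbF.
split=> [d|d|].
- rewrite C5; have -> : ar s7 7 d = ar s4 7 d by rewrite /= exec_ar.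
  have -> : ar s7 5 d = p d by rewrite /= exec_ar.
  case: (boolP (e i d)) => ed; last by rewrite nadj.
  by rewrite N7 // (omega_column iZ si ed).
- by rewrite exec_ar //= exec_ar.
rewrite exec_sc // s7_8 (omega_step iZ si); congr maxn.
apply: eq_big => [c|c _]; first by rewrite wn andbT.
rewrite addnC; congr (_ + _); apply: eq_bigr => d _.
by rewrite (minn_idPl (wn d)).
Qed.

Lemma init_ok s : (forall x y : 'I_n, ar s 0 (1 + x * n + y) = e x y) ->
  let s' := run init s in
  [/\ has_graph s', has_rows setT s', forall d : 'I_n, ar s' 5 d = 0,
      forall d : 'I_n, ar s' 6 d = 0 & sc s' 8 = 0].
Proof.
move=> s0; rewrite /init !exec_seq !exec_ass; set s1 := set_sc (set_sc s 5 _) 8 _.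
pose I k s' := [/\ sc s' 5 = 1 + k * n, forall x : 'I_n, x < k -> ar s' 1 x = 1 + x * n,
   forall x : 'I_n, x < k -> ar s' 2 x = 1, forall x : 'I_n, x < k -> ar s' 5 x = 0 &
   forall x : 'I_n, x < k -> ar s' 6 x = 0].
set body := CSeq _ _.
have [||[_ I1 I2 I5 I6] F1 F2] := @for_ind I 1 body s1.
- by split.
- move=> x s2 _ _ [I0 I1 I2 I5 I6]; rewrite /body !exec_seq !exec_sto !exec_ass.
  have upd_ok (f : nat -> nat) v (g : nat -> nat) : g x = v ->
      (forall y : 'I_n, y < x -> f y = g y) -> forall y : 'I_n, y < x.+1 -> upd f x v y = g y.
    move=> gx fg y; rewrite ltnS leq_eqVlt updE => /orP[/eqP->|lt]; first by rewrite eqxx.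
    by rewrite ltn_eqF // fg.
  split.
  + by rewrite /= /upd /= I0 mulSn; lia.
  + by apply: (upd_ok _ _ (fun y => 1 + y * n)) => //=; rewrite updE /= I0.
  + by apply: (upd_ok _ _ (fun=> 1)).
  + by apply: (upd_ok _ _ (fun=> 0)).
  + by apply: (upd_ok _ _ (fun=> 0)).
split=> [|x|d|d|]; rewrite ?I5 ?I6 ?F1 ?I2 ?inE //.
by split=> [x|x y]; rewrite ?I1 // F2 //= s0.
Qed.

Lemma program_ok s : (forall x y : 'I_n, ar s 0 (1 + x * n + y) = e x y) ->
  sc (run program s) 8 = omega e setT.
Proof.
move=> s0; have [hg hR h5 h6 h8] := init_ok s0.
rewrite /program exec_seq exec_seq; set s1 := run init s in hg hR h5 h6 h8 *.
have el := eliminate_ok hg hR.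
apply: dynamic_ok => //; try by move=> d; rewrite exec_ar.
- by apply: has_graph_ar hg _ _; rewrite exec_ar.
- by rewrite exec_sc.
Qed.
End Correctness.

(** * The complete machine program and its running time *)

Lemma code_at_mid (l1 l2 l3 : seq instr) : code_at (l1 ++ l2 ++ l3) (size l1) l2.
Proof.
move=> i lti; rewrite nth_cat ltnNge leq_addr /= addKn nth_cat.
by rewrite lti.
Qed.

Lemma adjnE (n : nat) (e : rel 'I_n) (x y : 'I_n) : adjn e x y = e x y.
Proof.
apply/existsP/idP => [[x' /existsP[y' /and3P[/eqP/val_inj-> /eqP/val_inj->]]]|xy] //.
by exists x; apply/existsP; exists y; rewrite !eqxx.
Qed.

Lemma ram_correct (main : cmd) : wfc main -> exists P : seq instr,
  forall (n : nat) (m : nat -> nat), m 0 = n -> m 1 = 0 -> (forall r, 0 < r -> m r <= 1) ->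
  exists s t, [/\ forall k, 0 < k <= n * n -> ar s 0 k = m k,
    ram_halted P (ram_run P t (RamState 0 m)),
    regs (ram_run P t (RamState 0 m)) 0 = sc (exec n main s) 8 &
    t <= 200 + 4 * n + 13 * (n * n) + cost main * n.+1 ^ depth main + 2].
Proof.
move=> wf; pose b := compile main (size boot) 0.
pose fin := [:: IConst 0 0; IAdd 0 0 (var 8); IHalt].
pose P := boot ++ b ++ fin; exists P => n m m0 m1 mb.
have c0 : code_at P 0 boot := @code_at_mid [::] boot (b ++ fin).
have c1 : code_at P (size boot) b := @code_at_mid boot b fin.
have c2 : code_at P (size boot + size b) fin.
  by have := @code_at_mid (boot ++ b) fin [::]; rewrite cats0 -catA size_cat.
clearbody P.
have [t1 [m' [R1 m'0 m'A l1]]] := boot_ok c0 m0 m1 mb.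
(* Memory is taken as the boot code leaves it: remnants of the input may sit in variables and other
   arrays, and only array 0 is specified. *)
pose s := Store (fun v => m' (var v)) (fun a i => m' (slot a i)).
have rs : represents n s m' by split.
have [t2 [m'' [R2 [_ r8 _] _ l2]]] := compile_ok c1 wf rs.
have [i1 /code_at_cons[i2 /code_at_cons[i3 _]]] := code_at_cons c2.
have R3 : runs P 2 (size boot + size b) m'' (size boot + size b).+2
    (eff (eff m'' (IConst 0 0)) (IAdd 0 0 (var 8))).
  by rewrite /runs /ram_run /ram_step /= i1 /= i2.
have R := runs_trans (runs_trans R1 R2) R3.
exists s, (t1 + t2 + 2); rewrite /runs in R; rewrite R; split.
- by move=> k lk; rewrite -(m'A k lk) /= /slot addn0.
- by rewrite /ram_halted /= i3.
- by rewrite /= !updE /= r8.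
- by rewrite leq_add2r leq_add.
Qed.

(* There is a fixed RAM program P and a constant c such that on every chordal
   bipartite graph on n vertices, P halts within c * n^4 + c steps with the
   strong chromatic index of the graph in register 0. *)
Theorem theorem8 :
  exists (P : seq instr) (c : nat),
    forall (n : nat) (e : rel 'I_n),
      simple_graph e -> chordal_bipartite e ->
      exists t : nat,
        t <= c * n ^ 4 + c /\
        ram_halted P (ram_run P t (graph_input e)) /\
        is_strong_chromatic_index e (regs (ram_run P t (graph_input e)) 0).
Proof.
have [P HP] := ram_correct program_wf.
(* For positive [n], [n.+1 ^ 4] is at most [16 * n ^ 4], and 300 absorbs the lower order terms; the
   constant summand settles [n = 0]. *)
exists P, (16 * cost program + 300) => n e eS eB.
have [|||s [t [sA ht res lt]]] := HP n (regs (graph_input e)).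
- by [].
- rewrite /=; case: ifP => // n0; case: (n) e eS n0 {eB} => // n' e [_ eI] _.
  by rewrite div0n mod0n (@adjnE _ e ord0 ord0) (negbTE (eI _)).
- by move=> [|r] // _; rewrite /=; case: ifP => // _; case: (adjn _ _ _).
exists t; split; last split => //.
  apply: leq_trans lt _; rewrite program_depth; move: (cost program) => K; clear.
  case: n => [|n]; first by rewrite exp1n exp0n //; lia.
  have : n.+2 ^ 4 <= 16 * n.+1 ^ 4 by rewrite -[16]/(2 ^ 4) -expnMn leq_exp2r //; lia.
  have : n.+1 * n.+1 <= n.+1 ^ 4.
    by rewrite -[X in X <= _]/(n.+1 ^ 2) leq_pexp2l.
  have : n.+1 <= n.+1 * n.+1 by rewrite leq_pmulr.
  move: (n.+1 ^ 4) (n.+2 ^ 4) (n.+1 * n.+1) => A B C; nia.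
rewrite -[graph_input e]/(RamState 0 (regs (graph_input e))) res.
rewrite (program_ok (e := e)); first exact: strong_chromatic_index_omega.
  exact: exists_simple_row.
move=> x y; have ltxy : x * n + y < n * n.
  by have := ltn_ord x; have := ltn_ord y; nia.
rewrite sA; last by rewrite add1n ltxy.
have n0 : 0 < n by have := ltn_ord x; lia.
by rewrite -addnA add1n /= ltxy divnMDl // modnMDl divn_small // addn0 modn_small // adjnE.
Qed.
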